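(* Let $B$ be a supersoluble brace, and let $p$ be the largest prime in $\pi(B,+)\cup\{2\}$. Let $\pi$ be the set of all primes $q$ with $q\le p$. Then $B$ is residually $\pi$-finite, i.e., the intersection of all ideals $I$ of $B$ such that $B/I$ is finite of order divisible only by primes in $\pi$ is $\{0\}$.
   Context: A brace (skew left brace) is a set $B$ with two binary operations $+$ and $\cdot$ such that $(B,+)$ and $(B,\cdot)$ are groups and $a(b+c)=ab-a+ac$ for all $a,b,c\in B$. $\lambda_a(b)=-a+ab$ defines a homomorphism $\lambda\colon(B,\cdot)\to\operatorname{Aut}(B,+)$. An ideal is a subset that is a subgroup of both groups, normal in both, and invariant under all $\lambda_b$; quotients by ideals are braces. $\operatorname{Soc}(B)=\operatorname{Ker}\lambda\cap Z(B,+)$. $B$ is supersoluble if there is a finite chain of ideals $\{0\}=I_0\le\dots\le I_n=B$ such that for each $i$, either $(I_{i+1}/I_i,+)$ is infinite cyclic and $I_{i+1}/I_i\le\operatorname{Soc}(B/I_i)$, or $I_{i+1}/I_i$ has prime order. $\pi(B,+)$ is the set of primes $r$ such that $(B,+)$ has an element of order $r$. *)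

(* Defs.v *)
From mathcomp Require Import all_boot all_algebra.
Set Implicit Arguments. Unset Strict Implicit. Unset Printing Implicit Defensive.

Record brace := Brace {
  carrier :> Type;
  badd : carrier -> carrier -> carrier;
  bopp : carrier -> carrier;
  bzero : carrier;
  bmul : carrier -> carrier -> carrier;
  binv : carrier -> carrier;
  bone : carrier;
  baddA : forall a b c, badd a (badd b c) = badd (badd a b) c;
  badd0 : forall a, badd bzero a = a;
  baddN : forall a, badd (bopp a) a = bzero;
  bmulA : forall a b c, bmul a (bmul b c) = bmul (bmul a b) c;
  bmul1 : forall a, bmul bone a = a;
  bmulV : forall a, bmul (binv a) a = bone;
  bdistr : forall a b c,
    bmul a (badd b c) = badd (badd (bmul a b) (bopp a)) (bmul a c)
}.

Section BraceDefs.
Variable B : brace.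
Local Notation "x + y" := (badd x y).
Local Notation "- x" := (bopp x).
Local Notation "x * y" := (bmul x y).

Definition blambda (a b : B) : B := - a + a * b.

Definition is_ideal (I : B -> Prop) : Prop :=
  [/\ I (bzero B),
      (forall x y, I x -> I y -> I (x + y)) /\ (forall x, I x -> I (- x)),
      [/\ I (bone B), (forall x y, I x -> I y -> I (x * y)) & (forall x, I x -> I (binv x))],
      (forall b x, I x -> I (b + x + - b)) /\ (forall b x, I x -> I (b * x * binv b))
    & (forall b x, I x -> I (blambda b x))].

Fixpoint bnatmul (n : nat) (x : B) : B :=
  match n with O => bzero B | S m => x + bnatmul m x end.

Definition bintmul (z : int) (x : B) : B :=
  match z with Posz n => bnatmul n x | Negz n => - bnatmul n.+1 x end.

Definition index_is (I J : B -> Prop) (n : nat) : Prop :=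
  exists f : 'I_n -> B,
    [/\ forall i, J (f i),
        forall x, J x -> exists i, I (- f i + x)
      & forall i j, I (- f i + f j) -> i = j].

Definition quot_inf_cyclic (I J : B -> Prop) : Prop :=
  exists g, J g /\
    (forall x, J x -> exists z : int, I (- bintmul z g + x)) /\
    (forall z : int, I (bintmul z g) -> z = 0%R).

(* J/I <= Soc(B/I) = Ker lambda /\ Z(B/I,+) *)
Definition quot_in_soc (I J : B -> Prop) : Prop :=
  forall x, J x -> forall b,
    I (blambda x b + - b) /\ I (x + b + - x + - b).

Definition supersoluble : Prop :=
  exists (n : nat) (I : nat -> B -> Prop),
    [/\ forall x, I 0 x <-> x = bzero B,
        forall x, I n x,
        forall i, is_ideal (I i),
        forall i x, I i x -> I i.+1 x
      & forall i, i < n ->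
          (quot_inf_cyclic (I i) (I i.+1) /\ quot_in_soc (I i) (I i.+1))
          \/ (exists q, prime q /\ index_is (I i) (I i.+1) q)].

Definition in_pi_add (r : nat) : Prop :=
  prime r /\ exists x : B, x <> bzero B /\ bnatmul r x = bzero B.

Definition finite_quot_primes_le (p : nat) (I : B -> Prop) : Prop :=
  exists n, index_is I (fun _ => True) n /\ (forall q, prime q -> q %| n -> q <= p).

Definition residually_pi_finite_le (p : nat) : Prop :=
  forall x : B, (forall I, is_ideal I -> finite_quot_primes_le p I -> I x) ->
    x = bzero B.

End BraceDefs.

(* Main.v *)
(* Odd primes of a supersoluble series can be moved down: if [J < K] are
   consecutive ideals with [|K/J| = q] prime and [J] is either of prime order
   [r < q] or infinite cyclic in the socle (with [q] odd), then [J] is central in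
   both groups of [K], so either the [q]-torsion of [K] is an ideal of order [q]
   complementing [J], or [K] is again infinite cyclic in the socle.  Hence all
   factors of prime order [> p] may be assumed to be at the bottom, and there are
   none because such a bottom factor would give additive torsion.

   For residual finiteness take an infinite cyclic factor [J/F] lying in
   [Soc(B/F)], with [F/I] having a series of prime factors [<= p].  The ideals
   [F + mJ] with [m] a power of 2 separate the points outside [F].  For a point of
   [F], remove [F] one prime factor at a time: if [|F| = q], a generator [g] of
   [J/F] acts on [B] (by [lambda] and by conjugation) trivially modulo [F] and by
   an element of order dividing [q - 1] on [F], so some multiple of [g] by a number
   with prime factors [<= q] lies in [Soc(B)] and generates an ideal that meets [F]
   trivially. *)
Require Import Defs.
From mathcomp Require Import all_boot all_algebra.
From mathcomp Require Import fingroup perm cyclic boolp zify.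
Set Implicit Arguments. Unset Strict Implicit. Unset Printing Implicit Defensive.

(** * Groups of prime order *)
Section Group.
Variables (T : Type) (op : T -> T -> T) (inv : T -> T) (e : T).
Hypotheses (opA : forall a b c, op a (op b c) = op (op a b) c)
  (op1 : forall a, op e a = a) (opV : forall a, op (inv a) a = e).

Lemma grp_idem x : op x x = x -> x = e.
Proof. by move=> h; rewrite -(opV x) -{3}h opA opV op1. Qed.

Lemma grp_mulV x : op x (inv x) = e.
Proof. by apply: grp_idem; rewrite opA -(opA x (inv x) x) opV -opA op1. Qed.

Lemma grp_mul1 x : op x e = x.
Proof. by rewrite -(opV x) opA grp_mulV op1. Qed.

Lemma grp_mulKV x y : op (op x (inv y)) y = x.
Proof. by rewrite -opA opV grp_mul1. Qed.

Lemma grp_mulVK x y : op (op x y) (inv y) = x.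
Proof. by rewrite -opA grp_mulV grp_mul1. Qed.

Lemma grp_injr z : injective (fun x => op x z).
Proof. by move=> x y /= h; rewrite -(grp_mulVK x z) h grp_mulVK. Qed.

Lemma grp_injl z : injective (op z).
Proof. by move=> x y h; rewrite -(op1 x) -(opV z) -opA h opA opV op1. Qed.

Lemma grp_invK x : inv (inv x) = x.
Proof. by apply: (@grp_injr (inv x)); rewrite opV grp_mulV. Qed.

Lemma grp_invM x y : inv (op x y) = op (inv y) (inv x).
Proof. by apply: (@grp_injr (op x y)); rewrite opV opA -(opA (inv y)) opV grp_mul1 opV. Qed.

Lemma grp_inv1 : inv e = e.
Proof. by apply: (@grp_injr e); rewrite opV op1. Qed.

Fixpoint gpow (n : nat) (x : T) : T :=
  match n with O => e | S m => op x (gpow m x) end.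

Lemma gpowD m n x : gpow (m + n) x = op (gpow m x) (gpow n x).
Proof. by elim: m => [|m IH] /=; rewrite ?op1 // IH opA. Qed.

Lemma gpow1 x : gpow 1 x = x.
Proof. exact: grp_mul1. Qed.

Lemma gpow_e n : gpow n e = e.
Proof. by elim: n => //= n ->; rewrite op1. Qed.

Lemma gpowM m n x : gpow (m * n) x = gpow m (gpow n x).
Proof. by elim: m => [|m IH] //=; rewrite mulSn gpowD IH. Qed.

Lemma gpow_mod m n x : gpow m x = e -> gpow (n %% m) x = gpow n x.
Proof.
by move=> h; rewrite {2}(divn_eq n m) gpowD gpowM h gpow_e op1.
Qed.

Lemma gpow_comm x y n : op x y = op y x -> op (gpow n x) y = op y (gpow n x).
Proof.
by move=> h; elim: n => [|n IH] /=; rewrite ?op1 ?grp_mul1 // -opA IH !opA h.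
Qed.

Lemma gpow_op x y n : op x y = op y x ->
  gpow n (op x y) = op (gpow n x) (gpow n y).
Proof.
move=> h; elim: n => [|n IH] /=; first by rewrite op1.
by rewrite IH !opA -(opA x y) -(opA x (gpow n x)) (gpow_comm n h).
Qed.

Lemma gpow_closed (H : T -> Prop) n x : H e ->
  (forall x y, H x -> H y -> H (op x y)) -> H x -> H (gpow n x).
Proof. by move=> H1 HM Hx; elim: n => //= n IH; apply: HM. Qed.

(** Bezout: with [km * m = kn * n + 1], the element [x] is the inverse of a power of [gpow n x]
    times a power of [gpow m x]. *)
Lemma gpow_coprime (H : T -> Prop) m n x :
  H e -> (forall x y, H x -> H y -> H (op x y)) -> (forall x, H x -> H (inv x)) ->
  0 < m -> coprime m n -> H (gpow m x) -> H (gpow n x) -> H x.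
Proof.
move=> H1 HM HV m0 cmn Hm Hn; case: (egcdnP n m0) => km kn def _.
rewrite -(gpow1 x) -(eqP cmn) -(op1 (gpow _ x)) -(opV (gpow (kn * n) x)) -opA.
rewrite -gpowD -def !gpowM; apply: (HM).
  by apply: HV; apply: gpow_closed.
exact: gpow_closed.
Qed.

Definition gconj x y := op (op x y) (inv x).

Lemma gconjM x y z : gconj x (op y z) = op (gconj x y) (gconj x z).
Proof. by rewrite /gconj !opA grp_mulKV. Qed.

Lemma gconjMl x y z : gconj (op x y) z = gconj x (gconj y z).
Proof. by rewrite /gconj grp_invM !opA. Qed.

Lemma gconj1 z : gconj e z = z.
Proof. by rewrite /gconj grp_inv1 op1 grp_mul1. Qed.

Lemma gconj_inj x : injective (gconj x).
Proof. by move=> y z /grp_injr /grp_injl. Qed.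

Lemma gconj_pow x n z : gconj (gpow n x) z = iter n (gconj x) z.
Proof. by elim: n => [|n IH] /=; rewrite ?gconj1 // gconjMl IH. Qed.

Lemma gconj_id x y : gconj x y = y <-> op x y = op y x.
Proof.
split=> [h|h]; last by rewrite /gconj h grp_mulVK.
by rewrite -{2}h /gconj grp_mulKV.
Qed.

Section HomPow.
Variable a : T -> T.
Hypothesis aM : forall x y, a (op x y) = op (a x) (a y).

Lemma endo_e : a e = e.
Proof. by apply: grp_idem; rewrite -aM op1. Qed.

Lemma endo_pow n x : a (gpow n x) = gpow n (a x).
Proof. by elim: n => [|n IH] /=; rewrite ?endo_e // aM IH. Qed.

Lemma endo_inv x : a (inv x) = inv (a x).
Proof. by apply: (@grp_injr (a x)); rewrite -aM !opV endo_e. Qed.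
End HomPow.

(** * Closed subsets with a prime number of elements *)

Section PrimeOrder.
Variables (q : nat) (H : T -> Prop) (f : 'I_q -> T).
Hypotheses (pq : prime q) (HM : forall x y, H x -> H y -> H (op x y))
  (Hf : forall i, H (f i)) (fH : forall x, H x -> exists i, x = f i)
  (finj : injective f).

(* Cayley: left translations embed [H] into the permutations of ['I_q]. *)
Lemma prime_order_perm : exists s : T -> {perm 'I_q},
  [/\ forall x y, H x -> H y -> s (op x y) = (s y * s x)%g,
      forall x y, H x -> H y -> s x = s y -> x = y
    & #|[set s (f i) | i : 'I_q]| = q].
Proof.
have [g gP] : {g : T -> 'I_q & forall x, H x -> x = f (g x)}.
  apply: (@choice _ _ (fun x i => H x -> x = f i)) => x.
  case: (EM (H x)) => [/fH[i ->]|nx]; first by exists i.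
  by exists (Ordinal (prime_gt0 pq)).
(* Translation by an element outside [H] is replaced by the identity, so that [t x] is injective for
   every [x]. *)
pose t x i := if `[< H x >] then g (op x (f i)) else i.
have tE x i : H x -> f (t x i) = op x (f i).
  by move=> Hx; rewrite /t (asboolT Hx) -gP //; apply: HM.
have tinj x : injective (t x).
  rewrite /t; case: asboolP => [Hx|_] i j E //; apply/finj/(@grp_injl x).
  by rewrite (gP _ (HM Hx (Hf i))) (gP _ (HM Hx (Hf j))) E.
pose s x := perm (tinj x).
have sI x y : H x -> H y -> s x = s y -> x = y.
  move=> Hx Hy /permP/(_ (Ordinal (prime_gt0 pq))); rewrite !permE => E.
  by apply: (@grp_injr (f (Ordinal (prime_gt0 pq)))); rewrite -!tE ?E.
exists s; split=> //.
  move=> x y Hx Hy; apply/permP => i; rewrite permM !permE; apply: finj.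
  by rewrite (tE _ _ (HM Hx Hy)) tE // tE // opA.
by rewrite card_imset ?card_ord // => i j /(sI _ _ (Hf i) (Hf j))/finj.
Qed.

(** Only closure under [op] is given. If [s x] has order [n], then [s x ^+ n.+1 = s x], so
    [gpow n.+1 x = x] by injectivity of [s] on [H]. Cancelling [x] shows that [e] is the power
    [gpow n x], and [n] is positive. *)
Lemma prime_order_e : H e.
Proof.
have [s [sM sI cs]] := prime_order_perm.
have [x Hx] : exists x, H x by exists (f (Ordinal (prime_gt0 pq))).
have HP n : H (gpow n.+1 x).
  by elim: n => [|n IH]; [rewrite gpow1 | exact: (HM Hx IH)].
have sP n : s (gpow n.+1 x) = (s x ^+ n.+1)%g.
  elim: n => [|n IH]; first by rewrite gpow1 expg1.
  by rewrite -[gpow n.+2 x]/(op x (gpow n.+1 x)) sM // IH [RHS]expgSr.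
have := sP #[s x]%g; rewrite expgSr expg_order mul1g => /(sI _ _ (HP _) Hx) E.
suff <- : gpow #[s x]%g x = e by rewrite -(ltn_predK (order_gt0 (s x))).
by apply: (@grp_injl x); rewrite grp_mul1.
Qed.

(** Carries questions about [H] to a finite group, where Lagrange's theorem applies. The embedding
    reverses products, which does not affect powers. *)
Lemma prime_order_group : exists (G : {group {perm 'I_q}}) (s : T -> {perm 'I_q}),
  [/\ #|G| = q, forall x, H x -> s x \in G,
      forall n x, H x -> s (gpow n x) = (s x ^+ n)%g
    & forall x y, H x -> H y -> s x = s y -> x = y].
Proof.
have [s [sM sI cs]] := prime_order_perm; have He := prime_order_e.
have se : s e = 1%g by apply: (mulgI (s e)); rewrite -sM // op1 mulg1.
have gs : group_set [set s (f i) | i : 'I_q].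
  apply/group_setP; split.
    by have [i E] := fH He; apply/imsetP; exists i; rewrite // -E se.
  move=> _ _ /imsetP[i _ ->] /imsetP[j _ ->].
  have [k E] := fH (HM (Hf j) (Hf i)).
  by apply/imsetP; exists k; rewrite // -E sM.
exists (group gs), s; split=> //.
  by move=> x /fH[i ->]; apply/imsetP; exists i.
move=> n x Hx; elim: n => [|n IH] /=; first by rewrite se expg0.
by rewrite sM ?IH ?expgSr //; apply: gpow_closed.
Qed.

Lemma prime_order_pow x : H x -> gpow q x = e.
Proof.
have [G [s [cG sG sX sI]]] := prime_order_group => Hx; have He := prime_order_e.
apply: sI => //; first exact: gpow_closed.
have := order_dvdG (sG _ Hx); rewrite cG order_dvdn => /eqP E.
by rewrite sX // E (sX 0 x Hx).
Qed.

Lemma prime_order_gen x y : H x -> H y -> y <> e -> exists k, x = gpow k y.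
Proof.
have [G [s [cG sG sX sI]]] := prime_order_group => Hx Hy ny; have He := prime_order_e.
have sy1 : s y != 1%g.
  by apply/eqP => E; apply/ny/sI => //; rewrite E -(expg0 (s y)) -sX.
have GE : G :=: <[s y]>%g.
  suff o : #[s y]%g = #|G| by apply/esym/eqP; rewrite eqEcard cycle_subG sG //= -o orderE.
  have := order_dvdG (sG _ Hy); rewrite cG => /(prime_nt_dvdP pq _) -> //.
  by rewrite order_eq1.
have /cycleP[k E] : s x \in <[s y]>%g by rewrite -GE sG.
by exists k; apply: sI => //; [exact: gpow_closed | rewrite sX].
Qed.

Lemma prime_order_nt : exists2 y, H y & y <> e.
Proof.
have [i Ei] := fH prime_order_e.
have [j nj] : exists j : 'I_q, j != i.
  have : 1 < #|'I_q| by rewrite card_ord prime_gt1.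
  rewrite (cardD1 i) inE /= -[1]addn0 ltn_add2l => /card_gt0P[j].
  by rewrite !inE => /andP[? _]; exists j.
by exists (f j) => //; rewrite Ei => /finj E; rewrite E eqxx in nj.
Qed.

Lemma prime_order_comm x y : H x -> H y -> op x y = op y x.
Proof.
move=> Hx Hy; have [z Hz nz] := prime_order_nt.
have [i ->] := prime_order_gen Hx Hz nz; have [j ->] := prime_order_gen Hy Hz nz.
by rewrite -!gpowD addnC.
Qed.

(** On a generator [z] the map is [z |-> gpow k z] with [k] prime to [q], and [k ^ q.-1] is 1 modulo
    [q] by Euler's theorem. *)
Lemma prime_order_aut (a : T -> T) x :
  (forall x y, a (op x y) = op (a x) (a y)) -> injective a ->
  (forall x, H x -> H (a x)) -> H x -> iter q.-1 a x = x.
Proof.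
move=> aM ai aH Hx; have [z Hz nz] := prime_order_nt.
have [k Ek] := prime_order_gen (aH _ Hz) Hz nz.
have ck : coprime k q.
  rewrite coprime_sym prime_coprime //; apply/negP => /dvdnP[m km].
  apply/nz/ai; rewrite Ek km gpowM prime_order_pow // gpow_e.
  by rewrite (endo_e aM).
have [n ->] := prime_order_gen Hx Hz nz.
have aiM m u v : iter m a (op u v) = op (iter m a u) (iter m a v).
  by elim: m => //= m ->; rewrite aM.
rewrite (endo_pow (aiM _)); congr gpow.
have -> m : iter m a z = gpow (k ^ m) z.
  elim: m => [|m IH]; first by rewrite expn0 gpow1.
  by rewrite iterS IH (endo_pow aM) Ek -gpowM expnSr.
have /eqP := Euler_exp_totient ck; rewrite totient_prime // => /eqP E.
by rewrite -(gpow_mod _ (prime_order_pow Hz)) E gpow_mod ?prime_order_pow ?gpow1.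
Qed.

(** Both [gpow q.-1 x] and [gpow m x] centralise [H]: the first because conjugation by [x] has order
    dividing [q.-1] on [H], the second because it lies in the abelian group [H]. Coprimality gives
    the same for [x]. *)
Lemma prime_order_central m x y : H y -> (forall z, H z -> H (gconj x z)) ->
  H (gpow m x) -> coprime q.-1 m -> op x y = op y x.
Proof.
move=> Hy Hx Hm cm; apply: (@gpow_coprime (fun x => op x y = op y x) q.-1 m) => //.
- by rewrite op1 grp_mul1.
- by move=> u v hu hv; rewrite -opA hv opA hu opA.
- by move=> u hu; apply: (@grp_injl u); rewrite !opA grp_mulV op1 hu grp_mulVK.
- by rewrite -ltnS (ltn_predK (prime_gt0 pq)) prime_gt1.
- apply/gconj_id; rewrite gconj_pow prime_order_aut //.
  + exact: gconjM.
  + exact: gconj_inj.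
- exact: prime_order_comm.
Qed.

End PrimeOrder.
End Group.

(** * Arithmetic of braces *)
Declare Scope brace_scope.
Delimit Scope brace_scope with B.
Notation "x + y" := (badd x y) : brace_scope.
Notation "- x" := (bopp x) : brace_scope.
Notation "x * y" := (bmul x y) : brace_scope.
Local Open Scope brace_scope.

Section BraceTheory.
Variable B : brace.
Implicit Types x y z b : B.

Definition bpow := gpow (@bmul B) (bone B).
Definition bconj := gconj (@badd B) (@bopp B).

Lemma baddr0 x : x + bzero B = x.
Proof. exact: (grp_mul1 (@baddA B) (@badd0 B) (@baddN B)). Qed.
Lemma baddrN x : x + - x = bzero B.
Proof. exact: (grp_mulV (@baddA B) (@badd0 B) (@baddN B)). Qed.
Lemma baddNK x y : x + - y + y = x.
Proof. exact: (grp_mulKV (@baddA B) (@badd0 B) (@baddN B)). Qed.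
Lemma baddK x y : x + y + - y = x.
Proof. exact: (grp_mulVK (@baddA B) (@badd0 B) (@baddN B)). Qed.
Lemma boppK x : - - x = x.
Proof. exact: (grp_invK (@baddA B) (@badd0 B) (@baddN B)). Qed.
Lemma boppD x y : - (x + y) = - y + - x.
Proof. exact: (grp_invM (@baddA B) (@badd0 B) (@baddN B)). Qed.
Lemma bopp0 : - bzero B = bzero B.
Proof. exact: (grp_inv1 (@baddA B) (@badd0 B) (@baddN B)). Qed.
Lemma baddIr z : injective (fun x => x + z).
Proof. exact: (@grp_injr _ _ _ _ (@baddA B) (@badd0 B) (@baddN B)). Qed.
Lemma baddIl z : injective (badd z).
Proof. exact: (@grp_injl _ _ _ _ (@baddA B) (@badd0 B) (@baddN B)). Qed.

(* Rewriting with these rules computes the reduced form of a word in [(B, +)]. *)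
Definition baddE := (baddr0, @badd0 B, baddrN, @baddN B, baddNK, baddK, boppK,
  boppD, bopp0, @baddA B).

Lemma bsub0 x y : - x + y = bzero B <-> x = y.
Proof.
split=> [h|->]; last by rewrite baddE.
by apply: (@baddIl (- x)); rewrite h baddE.
Qed.

Lemma bmulr1 x : x * bone B = x.
Proof. exact: (grp_mul1 (@bmulA B) (@bmul1 B) (@bmulV B)). Qed.
Lemma bmulrV x : x * binv x = bone B.
Proof. exact: (grp_mulV (@bmulA B) (@bmul1 B) (@bmulV B)). Qed.
Lemma bmulVK x y : x * binv y * y = x.
Proof. exact: (grp_mulKV (@bmulA B) (@bmul1 B) (@bmulV B)). Qed.
Lemma bmulK x y : x * y * binv y = x.
Proof. exact: (grp_mulVK (@bmulA B) (@bmul1 B) (@bmulV B)). Qed.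
Lemma bmulIl z : injective (bmul z).
Proof. exact: (@grp_injl _ _ _ _ (@bmulA B) (@bmul1 B) (@bmulV B)). Qed.
Lemma binvK x : binv (binv x) = x.
Proof. exact: (grp_invK (@bmulA B) (@bmul1 B) (@bmulV B)). Qed.

(** Distributivity with [b = c = 0] reads [a * 0 = a * 0 - a + a * 0], whence [a * 0 = a]; then take
    [a = 1]. *)
Lemma bone0 : bone B = bzero B.
Proof.
have E a : a * bzero B = a.
  have := bdistr a (bzero B) (bzero B); rewrite badd0 => h.
  have {}h : bzero B = - a + a * bzero B.
    by apply: (@baddIl (a * bzero B)); rewrite !baddE.
  by apply: (@baddIl (- a)); rewrite -h baddE.
by rewrite -[LHS]E bmul1.
Qed.

Lemma bmulE x y : x * y = x + blambda x y.
Proof. by rewrite /blambda !baddE. Qed.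

Lemma blambdaD x y z : blambda x (y + z) = blambda x y + blambda x z.
Proof. by rewrite /blambda bdistr !baddE. Qed.

Lemma blambda0 x : blambda x (bzero B) = bzero B.
Proof. by rewrite /blambda -bone0 bmulr1 bone0 baddE. Qed.

Lemma blambdaN x y : blambda x (- y) = - blambda x y.
Proof. by apply/esym/bsub0; rewrite boppK -blambdaD baddE blambda0. Qed.

Lemma blambdaM x y z : blambda (x * y) z = blambda x (blambda y z).
Proof.
have -> : blambda y z = - y + y * z by [].
rewrite blambdaD blambdaN /blambda -bmulA {1}[x * y]bmulE.
by rewrite /blambda !baddE.
Qed.

Lemma blambda1 z : blambda (bone B) z = z.
Proof. by rewrite /blambda bmul1 bone0 !baddE. Qed.

Lemma blambdaVK x z : blambda (binv x) (blambda x z) = z.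
Proof. by rewrite -blambdaM bmulV blambda1. Qed.

Lemma blambdaKV x z : blambda x (blambda (binv x) z) = z.
Proof. by rewrite -blambdaM bmulrV blambda1. Qed.

Lemma blambda_inj x : injective (blambda x).
Proof. exact: can_inj (blambdaVK x). Qed.

Lemma blambda_pow n x z : blambda (bpow n x) z = iter n (blambda x) z.
Proof.
elim: n => [|n IH]; first exact: blambda1.
by rewrite iterS -IH -blambdaM.
Qed.

Lemma baddM x y : x + y = x * blambda (binv x) y.
Proof. by rewrite bmulE blambdaKV. Qed.

Lemma bnatmulD m n x : bnatmul (m + n)%N x = bnatmul m x + bnatmul n x.
Proof. exact: (gpowD (@baddA B) (@badd0 B)). Qed.

Lemma bnatmul1 x : bnatmul 1 x = x.
Proof. exact: baddr0. Qed.

Lemma bnatmulM m n x : bnatmul (m * n)%N x = bnatmul m (bnatmul n x).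
Proof. exact: (gpowM (@baddA B) (@badd0 B)). Qed.

Lemma bnatmulSr n x : bnatmul n.+1 x = bnatmul n x + x.
Proof. by rewrite -addn1 bnatmulD bnatmul1. Qed.

Lemma bnatmul0r n : bnatmul n (bzero B) = bzero B.
Proof. exact: (gpow_e (@badd0 B)). Qed.

Lemma bnatmulDr n x y : x + y = y + x -> bnatmul n (x + y) = bnatmul n x + bnatmul n y.
Proof. exact: (gpow_op (@baddA B) (@badd0 B) (@baddN B)). Qed.

Lemma bpowMr n x y : x * y = y * x -> bpow n (x * y) = bpow n x * bpow n y.
Proof. exact: (gpow_op (@bmulA B) (@bmul1 B) (@bmulV B)). Qed.

Lemma bpow_conj n b x : bpow n (b * x * binv b) = b * bpow n x * binv b.
Proof.
have M u v : b * (u * v) * binv b = b * u * binv b * (b * v * binv b).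
  by rewrite !bmulA bmulVK.
by rewrite /bpow -(endo_pow (@bmulA B) (@bmul1 B) (@bmulV B) M).
Qed.

Lemma bnatmulE n x : bnatmul n x = bintmul n%:Z x.
Proof. by []. Qed.

Lemma bintmulS (m : int) x : bintmul (m + 1)%R x = bintmul m x + x.
Proof.
case: m => [n|[|n]].
- by rewrite -[(n%:Z + 1)%R]/(Posz (n + 1)) addn1 -bnatmulSr.
- by rewrite /= !baddE.
- have -> : (Negz n.+1 + 1 = Negz n)%R by lia.
  have -> : bintmul (Negz n.+1) x = - (x + bnatmul n.+1 x) by [].
  by rewrite boppD baddNK.
Qed.

Lemma bintmulB1 (m : int) x : bintmul (m - 1)%R x = bintmul m x + - x.
Proof. by apply: (@baddIr x); rewrite -bintmulS GRing.subrK baddE. Qed.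

Lemma bintmul1 x : bintmul 1 x = x.
Proof. exact: baddr0. Qed.

Lemma bintmulD (m n : int) x : bintmul (m + n)%R x = bintmul m x + bintmul n x.
Proof.
elim/int_ind: n => [|n IH|n IH].
- by rewrite GRing.addr0 baddr0.
- by rewrite -addn1 PoszD GRing.addrA !bintmulS IH !baddE.
- have -> : (- (n.+1%:Z) = - n%:Z - 1)%R by lia.
  by rewrite GRing.addrA !bintmulB1 IH !baddE.
Qed.

Lemma bintmulN (m : int) x : bintmul (- m)%R x = - bintmul m x.
Proof. by apply/esym/bsub0; rewrite boppK -bintmulD GRing.subrr. Qed.

Lemma bintmulM (m n : int) x : bintmul (m * n)%R x = bintmul m (bintmul n x).
Proof.
elim/int_ind: m => [|m IH|m IH].
- by rewrite GRing.mul0r.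
- by rewrite -addn1 PoszD GRing.mulrDl GRing.mul1r !bintmulD IH [bintmul 1 _]bintmul1.
- have -> : (- (m.+1%:Z) = - m%:Z - 1)%R by lia.
  by rewrite GRing.mulrBl GRing.mul1r !bintmulD IH !bintmulN [bintmul 1 _]bintmul1.
Qed.

Lemma bintmul0 (m : int) : bintmul m (bzero B) = bzero B.
Proof. by case: m => n; rewrite /bintmul bnatmul0r ?bopp0. Qed.

Lemma bintmul_comm (m : int) x y : x + y = y + x ->
  bintmul m x + y = y + bintmul m x.
Proof.
move=> h; elim/int_ind: m => [|m IH|m IH].
- by rewrite /= !baddE.
- by rewrite -addn1 PoszD !bintmulS -baddA h !baddE IH.
- have -> : (- (m.+1%:Z) = - m%:Z - 1)%R by lia.
  have h' : - x + y = y + - x by apply: (@baddIl x); rewrite !baddE h baddE.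
  by rewrite !bintmulB1 -baddA h' !baddE IH.
Qed.

Definition ker_lambda x := forall b, blambda x b = b.
Definition badd_central x := forall b, x + b = b + x.

Lemma ker_lambdaD x y : ker_lambda x -> ker_lambda y -> ker_lambda (x + y).
Proof. by move=> hx hy b; rewrite -[y]hx -bmulE blambdaM hy hx. Qed.

Lemma ker_lambdaV x : ker_lambda x -> binv x = - x.
Proof.
move=> hx; apply: (@bmulIl x).
by rewrite bmulrV bmulE hx baddE bone0.
Qed.

Lemma ker_lambdaN x : ker_lambda x -> ker_lambda (- x).
Proof. by move=> hx b; rewrite -ker_lambdaV // -{1}[b]hx blambdaVK. Qed.

Lemma ker_lambda_natmul n x : ker_lambda x -> ker_lambda (bnatmul n x).
Proof.
move=> hx; elim: n => [|n IH]; last exact: ker_lambdaD.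
by move=> b; rewrite /= -bone0 blambda1.
Qed.

Lemma ker_lambda_pow n x : ker_lambda x -> bpow n x = bnatmul n x.
Proof.
move=> hx; elim: n => [|n IH]; first exact: bone0.
by rewrite -[LHS]/(x * bpow n x) IH bmulE hx.
Qed.

Lemma badd_central_natmul n x : badd_central x -> badd_central (bnatmul n x).
Proof. by move=> hx b; apply: (@bintmul_comm n). Qed.

Lemma bconjE x b : bconj x b = b <-> x + b = b + x.
Proof. exact: (gconj_id (@baddA B) (@badd0 B) (@baddN B)). Qed.

Lemma bconjD x y z : bconj x (y + z) = bconj x y + bconj x z.
Proof. exact: (gconjM (@baddA B) (@badd0 B) (@baddN B)). Qed.

Lemma bconj_inj x : injective (bconj x).
Proof. exact: (@gconj_inj _ _ _ _ (@baddA B) (@badd0 B) (@baddN B)). Qed.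

Lemma bconj_natmul n x z : bconj (bnatmul n x) z = iter n (bconj x) z.
Proof. exact: (gconj_pow (@baddA B) (@badd0 B) (@baddN B)). Qed.

Section Endo.
Variable a : B -> B.
Hypothesis aD : forall x y, a (x + y) = a x + a y.

Lemma badd_endoN x : a (- x) = - a x.
Proof. exact: (endo_inv (@baddA B) (@badd0 B) (@baddN B) aD). Qed.

Lemma badd_endo_nat n x : a (bnatmul n x) = bnatmul n (a x).
Proof. exact: (endo_pow (@baddA B) (@badd0 B) (@baddN B) aD). Qed.

Lemma badd_endo_int (m : int) x : a (bintmul m x) = bintmul m (a x).
Proof. by case: m => n; rewrite /bintmul ?badd_endoN badd_endo_nat. Qed.
End Endo.

Section Ideal.
Variable I : B -> Prop.
Hypothesis iI : is_ideal I.

Lemma ideal0 : I (bzero B). Proof. by case: iI. Qed.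
Lemma idealD x y : I x -> I y -> I (x + y). Proof. by case: iI => _ [] h _ _ _ _; apply: h. Qed.
Lemma idealN x : I x -> I (- x). Proof. by case: iI => _ [] _ h _ _ _; apply: h. Qed.
Lemma idealM x y : I x -> I y -> I (x * y). Proof. by case: iI => _ _ [] _ h _ _ _; apply: h. Qed.
Lemma idealV x : I x -> I (binv x). Proof. by case: iI => _ _ [] _ _ h _ _; apply: h. Qed.
Lemma ideal_conj b x : I x -> I (bconj b x). Proof. by case: iI => _ _ _ [] h _ _; apply: h. Qed.
Lemma ideal_mconj b x : I x -> I (b * x * binv b). Proof. by case: iI => _ _ _ [] _ h _; apply: h. Qed.
Lemma ideal_lambda b x : I x -> I (blambda b x). Proof. by case: iI => _ _ _ _ h; apply: h. Qed.

Lemma ideal1 : I (bone B). Proof. by rewrite bone0; apply: ideal0. Qed.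

Lemma ideal_natmul n x : I x -> I (bnatmul n x).
Proof. by move=> h; elim: n => [|n IH]; [apply: ideal0 | apply: idealD]. Qed.

Lemma ideal_intmul (m : int) x : I x -> I (bintmul m x).
Proof. by move=> h; case: m => n; [|apply: idealN]; apply: ideal_natmul. Qed.

Lemma ideal_pow n x : I x -> I (bpow n x).
Proof. by move=> h; elim: n => [|n IH]; [apply: ideal1 | apply: idealM]. Qed.

Lemma ideal_subl x y : I (- x + y) -> I x -> I y.
Proof. by move=> h hx; have := idealD hx h; rewrite !baddE. Qed.

Lemma ideal_sym x y : I (- x + y) -> I (- y + x).
Proof. by move=> /idealN; rewrite !baddE. Qed.

Lemma ideal_trans y x z : I (- x + y) -> I (- y + z) -> I (- x + z).
Proof. by move=> h1 h2; have := idealD h1 h2; rewrite !baddE. Qed.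

Lemma ideal_coprime m n x : (0 < m)%N -> coprime m n ->
  I (bnatmul m x) -> I (bnatmul n x) -> I x.
Proof.
by apply: (gpow_coprime (@baddA B) (@badd0 B) (@baddN B)) (ideal0) idealD idealN.
Qed.

Lemma ideal_mcoprime m n x : (0 < m)%N -> coprime m n ->
  I (bpow m x) -> I (bpow n x) -> I x.
Proof.
by apply: (gpow_coprime (@bmulA B) (@bmul1 B) (@bmulV B)) (ideal1) idealM idealV.
Qed.

(** Writing [t * b] as [b * (binv b * t * b)] gives [blambda t b = - t + b + blambda b s] with [s] a
    conjugate of [t]; both normalities and [blambda]-invariance of [I] then apply. *)
Lemma ideal_lambda_sub t b : I t -> exists2 f, I f & blambda t b = b + f.
Proof.
move=> It; exists (- b + blambda t b); last by rewrite !baddE.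
have -> : blambda t b = - t + b + blambda b (binv b * t * binv (binv b)).
  by rewrite -[RHS]baddA -bmulE binvK !bmulA bmulrV bmul1.
rewrite baddA; apply: idealD; last by apply: ideal_lambda; apply: ideal_mconj.
by have := ideal_conj (- b) (idealN It); rewrite /bconj /gconj !baddE.
Qed.

Lemma ideal_cong_add x x' y y' : I (- x + x') -> I (- y + y') ->
  I (- (x + y) + (x' + y')).
Proof.
move=> hx hy; have := idealD (ideal_conj (- y) hx) hy.
by rewrite /bconj /gconj !baddE.
Qed.

Lemma ideal_cong_opp x x' : I (- x + x') -> I (- (- x) + - x').
Proof.
move=> /idealN/(ideal_conj x); by rewrite /bconj /gconj !baddE.
Qed.

(** Additive and multiplicative cosets of an ideal coincide, since [- x + y] is the image of
    [binv x * y] under [blambda x]. This makes multiplication well defined on the quotient. *)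
Lemma ideal_cong_div x y : I (- x + y) <-> I (binv x * y).
Proof.
have E : - x + y = blambda x (binv x * y) by rewrite /blambda bmulA bmulrV bmul1.
split=> [|h]; last by rewrite E; apply: ideal_lambda.
by rewrite E => /(ideal_lambda (binv x)); rewrite blambdaVK.
Qed.

Lemma ideal_cong_mul x x' y y' : I (- x + x') -> I (- y + y') ->
  I (- (x * y) + (x' * y')).
Proof.
move=> /ideal_cong_div hx /ideal_cong_div hy; apply/ideal_cong_div.
have := idealM (ideal_mconj (binv y) hx) hy.
rewrite (grp_invM (@bmulA B) (@bmul1 B) (@bmulV B)) binvK.
by rewrite !bmulA bmulK.
Qed.

Lemma ideal_cong_inv x x' : I (- x + x') -> I (- (binv x) + binv x').
Proof.
move=> /ideal_cong_div/idealV/(ideal_mconj x) h; apply/ideal_cong_div.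
by move: h; rewrite (grp_invM (@bmulA B) (@bmul1 B) (@bmulV B)) !binvK !bmulA bmulK.
Qed.
End Ideal.

End BraceTheory.

(** * Brace homomorphisms *)

Section Hom.
Variables (B Q : brace) (phi : B -> Q).
Definition is_hom := (forall x y, phi (x + y) = phi x + phi y) /\
  (forall x y, phi (x * y) = phi x * phi y).
Hypothesis hphi : is_hom.

Lemma homD x y : phi (x + y) = phi x + phi y. Proof. by case: hphi. Qed.
Lemma homM x y : phi (x * y) = phi x * phi y. Proof. by case: hphi. Qed.
Lemma hom0 : phi (bzero B) = bzero Q.
Proof. by apply: (grp_idem (@baddA Q) (@badd0 Q) (@baddN Q)); rewrite -homD baddE. Qed.
Lemma homN x : phi (- x) = - phi x.
Proof. by apply/esym/bsub0; rewrite boppK -homD baddE hom0. Qed.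
Lemma homV x : phi (binv x) = binv (phi x).
Proof. by apply: (@bmulIl _ (phi x)); rewrite -homM !bmulrV !bone0 hom0. Qed.
Lemma hom_lambda x y : phi (blambda x y) = blambda (phi x) (phi y).
Proof. by rewrite /blambda homD homN homM. Qed.
Lemma hom_natmul n x : phi (bnatmul n x) = bnatmul n (phi x).
Proof. by elim: n => [|n IH]; rewrite /= ?hom0 ?homD ?IH. Qed.
Lemma hom_intmul (m : int) x : phi (bintmul m x) = bintmul m (phi x).
Proof. by case: m => n; rewrite /bintmul ?homN hom_natmul. Qed.
Lemma hom_pow n x : phi (bpow n x) = bpow n (phi x).
Proof. by elim: n => [|n IH]; [rewrite /bpow/= !bone0 hom0|rewrite [LHS]homM IH]. Qed.
End Hom.

(** * Quotient braces *)
Section Quotient.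
Variables (B : brace) (I : B -> Prop).
Hypothesis iI : is_ideal I.

(* A coset is represented by a chosen element of it. *)
Lemma coset_repr : {r : B -> B | (forall x, I (- x + r x)) /\
  (forall x y, I (- x + y) -> r x = r y)}.
Proof.
have ex x : exists y, I (- x + y) by exists x; rewrite baddE; apply: ideal0.
exists (fun x => sval (cid (ex x))); split=> [x|x y h]; first exact: (svalP (cid (ex x))).
(* Congruent elements have equal coset predicates, so [cid] chooses the same representative for
   both. *)
have E : (fun z => I (- x + z)) = (fun z => I (- y + z)).
  apply/funext => z; apply/propext; split; apply: ideal_trans => //.
  exact: ideal_sym.
by move: (ex x) (ex y); rewrite E => e1 e2; rewrite (Prop_irrelevance e1 e2).
Qed.

Let r := sval coset_repr.
Let rI x : I (- x + r x). Proof. by case: (svalP coset_repr). Qed.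
Let rE x y : I (- x + y) -> r x = r y. Proof. by case: (svalP coset_repr) => _; apply. Qed.
Let rr x : r (r x) = r x. Proof. exact/esym/rE. Qed.
Let Qt := {x : B | r x = x}.
Let pr (x : B) : Qt := exist _ (r x) (rr x).

Let prE x y : pr x = pr y <-> I (- x + y).
Proof.
split=> [[E]|h].
  by apply: (ideal_trans iI (rI x)); rewrite E; apply/(ideal_sym iI).
by rewrite /pr; move: (rr x) (rr y); rewrite (rE h) => e1 e2; rewrite (Prop_irrelevance e1 e2).
Qed.

Let prK (q : Qt) : pr (sval q) = q.
Proof.
case: q => x h; rewrite /pr /=; move: (rr x); rewrite h => e.
by rewrite (Prop_irrelevance e h).
Qed.

Let prI x : I (- sval (pr x) + x). Proof. exact/(ideal_sym iI). Qed.

Let qadd (x y : Qt) := pr (sval x + sval y).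
Let qopp (x : Qt) := pr (- sval x).
Let qmul (x y : Qt) := pr (sval x * sval y).
Let qinv (x : Qt) := pr (binv (sval x)).

Let qaddE x y : qadd (pr x) (pr y) = pr (x + y).
Proof. by apply/prE; apply: (ideal_cong_add iI); apply: prI. Qed.
Let qmulE x y : qmul (pr x) (pr y) = pr (x * y).
Proof. by apply/prE; apply: (ideal_cong_mul iI); apply: prI. Qed.
Let qoppE x : qopp (pr x) = pr (- x).
Proof. by apply/prE; apply: (ideal_cong_opp iI); apply: prI. Qed.
Let qinvE x : qinv (pr x) = pr (binv x).
Proof. by apply/prE; apply: (ideal_cong_inv iI); apply: prI. Qed.

Lemma quotient_brace : exists (Q : brace) (phi : B -> Q),
  [/\ is_hom phi, forall q, exists x, phi x = q & forall x, phi x = bzero Q <-> I x].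
Proof.
unshelve eexists (@Brace Qt qadd qopp (pr (bzero B)) qmul qinv (pr (bone B)) _ _ _ _ _ _ _).
- by move=> a b c; rewrite -(prK a) -(prK b) -(prK c) !qaddE baddA.
- by move=> a; rewrite -(prK a) !qaddE badd0.
- by move=> a; rewrite -(prK a) qoppE !qaddE baddN.
- by move=> a b c; rewrite -(prK a) -(prK b) -(prK c) !qmulE bmulA.
- by move=> a; rewrite -(prK a) !qmulE bmul1.
- by move=> a; rewrite -(prK a) qinvE !qmulE bmulV.
- move=> a b c; rewrite -(prK a) -(prK b) -(prK c).
  by rewrite qaddE !qmulE qoppE !qaddE bdistr.
exists pr; split.
- by split=> x y /=; rewrite ?qaddE ?qmulE.
- by move=> q; exists (sval q); apply: prK.
- move=> x /=; split.
    by move/esym/prE; rewrite bopp0 badd0.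
  by move=> h; apply/esym/prE; rewrite bopp0 badd0.
Qed.
End Quotient.

Definition zero_ideal (B : brace) (x : B) : Prop := x = bzero B.

Definition inf_soc (B : brace) (I J : B -> Prop) :=
  quot_inf_cyclic I J /\ quot_in_soc I J.

(** * Ideals and factors along surjective homomorphisms *)

Section Transport.
Variables (B Q : brace) (phi : B -> Q).
Hypotheses (hphi : is_hom phi) (phi_surj : forall q, exists x, phi x = q).

Lemma is_ideal_comp (P : Q -> Prop) : is_ideal P -> is_ideal (fun x => P (phi x)).
Proof.
move=> iP; split.
- by rewrite (hom0 hphi); apply: ideal0.
- split=> [x y|x]; first by rewrite (homD hphi); apply: idealD.
  by rewrite (homN hphi); apply: idealN.
- split=> [|x y|x].
  + by rewrite bone0 (hom0 hphi); apply: ideal0.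
  + by rewrite (homM hphi); apply: idealM.
  + by rewrite (homV hphi); apply: idealV.
- split=> b x h; first by rewrite !(homD hphi) (homN hphi); apply: ideal_conj.
  by rewrite !(homM hphi) (homV hphi); apply: ideal_mconj.
- by move=> b x h; rewrite (hom_lambda hphi); apply: ideal_lambda.
Qed.

Lemma is_ideal_im (K : B -> Prop) : is_ideal K ->
  is_ideal (fun q => exists2 x, K x & phi x = q).
Proof.
move=> iK; split.
- by exists (bzero B); [apply: ideal0 | rewrite (hom0 hphi)].
- split=> [_ _ [x Kx <-] [y Ky <-]|_ [x Kx <-]].
    by exists (x + y); [apply: idealD | rewrite (homD hphi)].
  by exists (- x); [apply: idealN | rewrite (homN hphi)].
- split=> [|_ _ [x Kx <-] [y Ky <-]|_ [x Kx <-]].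
  + by exists (bone B); [apply: ideal1 | rewrite !bone0 (hom0 hphi)].
  + by exists (x * y); [apply: idealM | rewrite (homM hphi)].
  + by exists (binv x); [apply: idealV | rewrite (homV hphi)].
- split=> b _ [x Kx <-]; have [c <-] := phi_surj b.
    exists (bconj c x); first exact: ideal_conj.
    by rewrite /bconj /gconj !(homD hphi) (homN hphi).
  exists (c * x * binv c); first exact: ideal_mconj.
  by rewrite !(homM hphi) (homV hphi).
- move=> b _ [x Kx <-]; have [c <-] := phi_surj b.
  by exists (blambda c x); [apply: ideal_lambda | rewrite (hom_lambda hphi)].
Qed.

Lemma index_is_comp (P R : Q -> Prop) n :
  index_is (fun x => P (phi x)) (fun x => R (phi x)) n <-> index_is P R n.
Proof.
split=> [[f [f1 f2 f3]]|[f [f1 f2 f3]]].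
  exists (fun i => phi (f i)); split=> // [q|i j].
    have [x <-] := phi_surj q => /f2[i h].
    by exists i; rewrite -(homN hphi) -(homD hphi).
  by rewrite -(homN hphi) -(homD hphi) => /f3.
have [g gP] := choice (fun i => phi_surj (f i)).
exists g; split=> [i|x /f2[i h]|i j]; first by rewrite gP.
  by exists i; rewrite (homD hphi) (homN hphi) gP.
by rewrite (homD hphi) (homN hphi) !gP => /f3.
Qed.

Lemma inf_soc_comp (P R : Q -> Prop) :
  inf_soc (fun x => P (phi x)) (fun x => R (phi x)) <-> inf_soc P R.
Proof.
split=> [[[g [g1 [g2 g3]]] s]|[[g [g1 [g2 g3]]] s]].
  split.
    exists (phi g); split=> //; split=> [q|z].
      have [x <-] := phi_surj q => /g2[z h]; exists z.
      by rewrite -(hom_intmul hphi) -(homN hphi) -(homD hphi).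
    by rewrite -(hom_intmul hphi) => /g3.
  move=> q; have [x <-] := phi_surj q => Rx b; have [c <-] := phi_surj b.
  have [] := s x Rx c.
  by rewrite !(homD hphi, homN hphi, hom_lambda hphi).
have [h hP] := phi_surj g; split.
  exists h; rewrite hP; split=> //; split=> [x /g2[z hz]|z].
    by exists z; rewrite (homD hphi) (homN hphi) (hom_intmul hphi) hP.
  by rewrite (hom_intmul hphi) hP => /g3.
by move=> x /s hx b; rewrite !(homD hphi, homN hphi, hom_lambda hphi); apply: hx.
Qed.
End Transport.

(** Lets any statement about factors above [I] be proved for [I = 0]. The preimages are given as
    equalities of predicates, so that rewriting with them brings every hypothesis into the form
    handled by the transport lemmas. *)
Lemma quotient_reduction (B : brace) (I : B -> Prop) : is_ideal I ->
  exists (Q : brace) (phi : B -> Q),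
  [/\ is_hom phi, forall q, exists x, phi x = q,
      I = (fun x => zero_ideal (phi x)) &
      forall K, is_ideal K -> (forall x, I x -> K x) ->
        exists2 K', is_ideal K' & K = (fun x => K' (phi x))].
Proof.
move=> iI; have [Q [phi [hphi surj kerE]]] := quotient_brace iI.
exists Q, phi; split=> //; first by apply/funext => x; apply/propext; rewrite -kerE.
move=> K iK IK; exists (fun q => exists2 x, K x & phi x = q).
  exact: is_ideal_im.
apply/funext => x; apply/propext; split=> [Kx|[y Ky E]]; first by exists x.
apply: (ideal_subl iK) Ky; apply/IK/kerE.
by rewrite (homD hphi) (homN hphi) E baddE.
Qed.

Lemma index_zero (B : brace) (K : B -> Prop) n : index_is (@zero_ideal B) K n <->
  exists f : 'I_n -> B, [/\ forall i, K (f i), forall x, K x -> exists i, x = f i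
    & injective f].
Proof.
split=> [[f [f1 f2 f3]]|[f [f1 f2 f3]]]; exists f; split=> //.
- by move=> x /f2[i /bsub0 E]; exists i.
- by move=> i j E; apply/f3/bsub0.
- by move=> x /f2[i ->]; exists i; apply/bsub0.
- by move=> i j /bsub0/f3.
Qed.

Section PrimeIndex.
Variables (B : brace) (J K : B -> Prop) (q : nat).
Hypotheses (iJ : is_ideal J) (iK : is_ideal K) (JK : forall x, J x -> K x)
  (pq : prime q) (JKq : index_is J K q).

(** The image of [K] in [B/J] is closed under both operations and has [q] elements, so the results
    on groups of prime order hold for it additively and multiplicatively. *)
Lemma index_prime :
  [/\ forall x, K x -> J (bnatmul q x), forall x, K x -> J (bpow q x),
      forall x y, K x -> K y -> ~ J y -> exists k, J (- bnatmul k y + x)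
    & exists2 y, K y & ~ J y].
Proof.
have [Q [phi [hphi surj JE Kex]]] := quotient_reduction iJ.
have [K' iK' KE] := Kex K iK JK.
move: JKq; rewrite JE KE => /(index_is_comp hphi surj)/index_zero[f [f1 f2 f3]].
split=> [x Kx|x Kx|x y Kx Ky ny|].
- rewrite /zero_ideal (hom_natmul hphi).
  exact: (prime_order_pow (@baddA Q) (@badd0 Q) (@baddN Q) pq (idealD iK') f1).
- rewrite /zero_ideal (hom_pow hphi) -bone0.
  exact: (prime_order_pow (@bmulA Q) (@bmul1 Q) (@bmulV Q) pq (idealM iK') f1).
- have [k E] := prime_order_gen (@baddA Q) (@badd0 Q) (@baddN Q) pq (idealD iK')
    f1 f2 f3 Kx Ky ny.
  by exists k; rewrite /zero_ideal (homD hphi) (homN hphi) (hom_natmul hphi) E baddE.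
- have [y Ky ny] := prime_order_nt (@baddA Q) (@badd0 Q) (@baddN Q) pq
    (idealD iK') f1 f2 f3.
  by have [x E] := surj y; exists x; rewrite E.
Qed.
End PrimeIndex.

(** * Moving odd primes down *)
Section TorsionIdeal.
Variables (B : brace) (J K : B -> Prop) (q : nat) (y : B).
Hypotheses (iJ : is_ideal J) (iK : is_ideal K) (JK : forall x, J x -> K x)
  (pq : prime q) (JKq : index_is J K q)
  (Jtf : forall x, J x -> bnatmul q x = bzero B -> x = bzero B)
  (Jmtf : forall x, J x -> bpow q x = bone B -> x = bone B)
  (JKc : forall x j, K x -> J j -> x + j = j + x)
  (JKmc : forall x j, K x -> J j -> x * j = j * x)
  (Ky : K y) (nJy : ~ J y) (qy : bnatmul q y = bzero B).

(** This set turns out to be the group of multiples of [y], a complement of [J] in [K]. Described by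
    torsion, it is visibly invariant under every [blambda b] and every additive conjugation. *)
Definition torsion_part x := K x /\ bnatmul q x = bzero B.
Local Notation T := torsion_part.

Lemma torsion_part_decomp x : K x -> exists k j, J j /\ x = bnatmul k y + j.
Proof.
have [_ _ gen _] := index_prime iJ iK JK pq JKq.
move=> Kx; have [k h] := gen x y Kx Ky nJy.
by exists k, (- bnatmul k y + x); split; rewrite // !baddE.
Qed.

Lemma torsion_part_comm x z : K x -> K z -> x + z = z + x.
Proof.
have commD a b c : a + c = c + a -> b + c = c + b -> (a + b) + c = c + (a + b) :> B.
  by move=> h1 h2; rewrite -baddA h2 baddA h1 baddA.
move=> Kx Kz; have [k [j [Jj Ex]]] := torsion_part_decomp Kx.
have [l [i [Ji Ez]]] := torsion_part_decomp Kz.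
rewrite Ex; apply: (commD); last by rewrite [RHS]JKc.
rewrite Ez; apply/esym/commD; last by apply/esym/JKc => //; apply: (ideal_natmul iK).
by rewrite -!bnatmulD addnC.
Qed.

Lemma torsion_part_mul k : T (bnatmul k y).
Proof.
split; first exact: (ideal_natmul iK).
by rewrite -bnatmulM mulnC bnatmulM qy bnatmul0r.
Qed.

(** If [t = k y + j] with [j] in [J], multiplying by [q] leaves [q j = 0], and [J] has no
    [q]-torsion. *)
Lemma torsion_part_gen t : T t -> exists k, t = bnatmul k y.
Proof.
move=> [Kt qt]; have [k [j [Jj E]]] := torsion_part_decomp Kt.
exists k; rewrite E (Jtf Jj) ?baddr0 //.
have Kky := ideal_natmul iK k Ky.
move: qt; rewrite E bnatmulDr; last by rewrite JKc.
by have [_ ->] := torsion_part_mul k; rewrite badd0.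
Qed.

Lemma torsion_partD x z : T x -> T z -> T (x + z).
Proof.
move=> [Kx qx] [Kz qz]; split; first exact: (idealD iK).
by rewrite bnatmulDr ?qx ?qz ?badd0 //; apply: torsion_part_comm.
Qed.

Lemma torsion_partN x : T x -> T (- x).
Proof.
move=> [Kx qx]; split; first exact: (idealN iK).
by rewrite -[LHS]badd0 -{1}qx -bnatmulDr baddE ?bnatmul0r ?baddE.
Qed.

Lemma torsion_part_lambda b x : T x -> T (blambda b x).
Proof.
move=> [Kx qx]; split; first exact: (ideal_lambda iK).
by rewrite -(badd_endo_nat (blambdaD b)) qx blambda0.
Qed.

Lemma torsion_partM x z : T x -> T z -> T (x * z).
Proof. by move=> Tx Tz; rewrite bmulE; apply/torsion_partD/torsion_part_lambda. Qed.

Lemma torsion_part0 : T (bzero B).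
Proof. by split; [apply: ideal0 | rewrite bnatmul0r]. Qed.

(** The power lies in [T] by closure under products and in [J] since [K/J] has order [q]; these two
    meet trivially. *)
Lemma torsion_part_pow x : T x -> bpow q x = bone B.
Proof.
move=> Tx; have [_ qJ _ _] := index_prime iJ iK JK pq JKq.
have [Kp qp] : T (bpow q x).
  elim: q => [|n IH]; first by rewrite /bpow /= bone0; apply: torsion_part0.
  exact: torsion_partM.
by rewrite bone0; apply: Jtf => //; apply: qJ; case: Tx.
Qed.

Lemma torsion_part_ideal : is_ideal T.
Proof.
split; first exact: torsion_part0.
- by split; [exact: torsion_partD | exact: torsion_partN].
- split; [by rewrite bone0; exact: torsion_part0 | exact: torsion_partM | move=> x Tx].
  have -> : binv x = - blambda (binv x) x.
    by apply: (@baddIr _ (blambda (binv x) x)); rewrite -bmulE bmulV bone0 baddE.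
  exact/torsion_partN/torsion_part_lambda.
- split=> b x [Kx qx].
    split; first exact: (ideal_conj iK).
    by rewrite -[b + x + - b]/(bconj b x) -(badd_endo_nat (bconjD b)) qx /bconj /gconj !baddE.
  have Ks := ideal_mconj iK b Kx.
  (* The conjugate is rewritten as a product [j * t] with [j] in [J] and [t] in [T]. Its [q]-th
     power and that of [t] are 1, and [j] commutes with [t], so [j] has trivial [q]-th power and
     vanishes. *)
  have [k [j [Jj E]]] := torsion_part_decomp Ks.
  pose t := blambda (binv j) (bnatmul k y).
  have Tt : T t by apply/torsion_part_lambda/torsion_part_mul.
  have Kky := ideal_natmul iK k Ky.
  have Es : b * x * binv b = j * t by rewrite E JKc // baddM.
  suff j1 : j = bone B by rewrite Es j1 bmul1.
  apply: Jmtf => //.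
  have := bpow_conj q b x; rewrite Es bpowMr; last by apply/esym/JKmc => //; case: Tt.
  by rewrite (torsion_part_pow Tt) (torsion_part_pow (conj Kx qx)) !bmulr1 bmulrV.
- exact: torsion_part_lambda.
Qed.

Lemma torsion_part_index : index_is (@zero_ideal B) T q.
Proof.
apply/index_zero; exists (fun i => bnatmul i y); split=> [i|t|i j].
- exact: torsion_part_mul.
- move=> /torsion_part_gen[k ->]; exists (Ordinal (ltn_pmod k (prime_gt0 pq))).
  exact/esym/(gpow_mod (@baddA B) (@badd0 B)).
- wlog ij : i j / (i <= j)%N.
    by move=> W E; case/orP: (leq_total i j) => [/W|/W h]; [exact|exact/esym/h].
  (* If [i < j], then [y] is killed by [q] and by [j - i], which are coprime, forcing [y] into
     [J]. *)
  move=> E; apply/val_inj/eqP; rewrite eqn_leq ij leqNgt; apply/negP => lt; apply: nJy.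
  apply: (ideal_coprime iJ (m := q) (n := (j - i)%N)).
  + exact: prime_gt0.
  + by rewrite prime_coprime // gtnNdvd ?subn_gt0 // (leq_ltn_trans (leq_subr _ _)).
  + by rewrite qy; apply: ideal0.
  + suff -> : bnatmul (j - i) y = bzero B by apply: ideal0.
    by apply: (@baddIl _ (bnatmul i y)); rewrite -bnatmulD subnKC // baddE E.
Qed.

Lemma torsion_part_split x : K x -> exists j t, [/\ J j, T t & x = t + j].
Proof.
move=> /torsion_part_decomp[k [j [Jj ->]]].
by exists j, (bnatmul k y); split=> //; apply: torsion_part_mul.
Qed.
End TorsionIdeal.

(** * Interchanging the two lowest factors *)

Section Swap.
Variable B : brace.
Local Notation zero := (@zero_ideal B).

Lemma zero_is_ideal : is_ideal zero.
Proof.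
rewrite /zero_ideal; split=> //.
- by split=> [x y -> ->|x ->]; rewrite ?badd0 ?bopp0.
- by rewrite -bone0; split=> // [x y -> ->|x ->]; rewrite ?bmul1 // -[LHS]bmulr1 bmulV.
- split=> b x ->; first by rewrite !baddE.
  by rewrite -bone0 bmulr1 bmulrV.
- by move=> b x ->; rewrite blambda0.
Qed.

Lemma quot_in_soc_zero (J : B -> Prop) :
  quot_in_soc zero J <-> forall x, J x -> ker_lambda x /\ badd_central x.
Proof.
split=> [h x Jx|h x /h[h1 h2] b].
  split=> b; have [h1 h2] := h x Jx b; first by apply: (@baddIr _ (- b)); rewrite h1 baddE.
  by apply: (@baddIr _ (- x)); apply: (@baddIr _ (- b)); rewrite h2 !baddE.
by rewrite h1 h2 /zero_ideal !baddE.
Qed.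

Lemma swap_prime (J K : B -> Prop) r q : is_ideal J -> is_ideal K ->
  (forall x, J x -> K x) -> prime r -> prime q -> (r < q)%N ->
  index_is zero J r -> index_is J K q ->
  exists T, [/\ is_ideal T, forall x, T x -> K x, index_is zero T q & index_is T K r].
Proof.
move=> iJ iK JK pr pq rq Jr JKq.
have [Kq Kmq _ [x0 Kx0 nx0]] := index_prime iJ iK JK pq JKq.
have J0 x : zero x -> J x by move=> ->; apply: ideal0.
have [Jrt Jmrt _ _] := index_prime zero_is_ideal iJ J0 pr Jr.
have /index_zero[f [f1 f2 f3]] := Jr.
have crq : coprime q r by rewrite prime_coprime // gtnNdvd ?prime_gt0.
(* As [r - 1 < q], the action of [K/J] by conjugation on [J] is trivial, additively and
   multiplicatively. *)
have cr1 : coprime r.-1 q.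
  rewrite coprime_sym prime_coprime // gtnNdvd //; first by have := prime_gt1 pr; lia.
  by have := prime_gt1 pr; lia.
have Jtf x : J x -> bnatmul q x = bzero B -> x = bzero B.
  by move=> /Jrt h1 h2; apply: (ideal_coprime zero_is_ideal (prime_gt0 pq) crq).
have Jmtf x : J x -> bpow q x = bone B -> x = bone B.
  move=> /Jmrt h1; rewrite bone0 => h2.
  exact: (ideal_mcoprime zero_is_ideal (prime_gt0 pq) crq).
have JKc x j : K x -> J j -> x + j = j + x.
  move=> Kx Jj; apply: (prime_order_central (@baddA B) (@badd0 B) (@baddN B) pr
    (idealD iJ) f1 f2 f3 Jj _ (Kq x Kx) cr1) => z.
  exact: ideal_conj.
have JKmc x j : K x -> J j -> x * j = j * x.
  move=> Kx Jj; apply: (prime_order_central (@bmulA B) (@bmul1 B) (@bmulV B) pr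
    (idealM iJ) f1 f2 f3 Jj _ (Kmq x Kx) cr1) => z.
  exact: ideal_mconj.
(* Multiplying by [r] kills the [J]-part of [q x0], so [q y = 0]; since [r] is prime to [q], [y]
   stays outside [J]. *)
pose y := bnatmul r x0.
have Ky : K y by apply: ideal_natmul.
have nJy : ~ J y.
  by move=> Jy; apply/nx0/(ideal_coprime iJ (prime_gt0 pq) crq) => //; apply: Kq.
have qy : bnatmul q y = bzero B.
  by rewrite /y -bnatmulM mulnC bnatmulM; apply/Jrt/Kq.
exists (torsion_part K q); split.
- exact: (torsion_part_ideal iJ iK JK pq JKq Jtf Jmtf JKc JKmc Ky nJy qy).
- by move=> x [].
- exact: (torsion_part_index iJ iK JK pq JKq Jtf JKc Ky nJy qy).
(* The elements of [J] represent the cosets of its complement [T] in [K]. *)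
exists f; split=> [i|x Kx|i j [_ h]]; first exact: JK.
  have [j [t [Jj Tt ->]]] := torsion_part_split iJ iK JK pq JKq Ky nJy qy Kx.
  have [i ->] := f2 _ Jj; exists i.
  by rewrite (JKc t) // ?baddE //; case: Tt.
apply/f3/bsub0/Jtf => //.
by apply: (idealD iJ) => //; apply: (idealN iJ).
Qed.

Lemma odd_expz_eq1 (k : int) n : odd n -> (k ^+ n = 1)%R -> k = 1%R.
Proof.
move=> on kn; have n0 : (0 < n)%N by case: n on {kn}.
have /eqP : (`|k| ^ n = 1 ^ n)%N by rewrite -abszX kn exp1n.
rewrite eqn_exp2r // => /eqP k1.
have [->//|E] : k = 1%R \/ k = (-1)%R by lia.
by move: kn; rewrite E -GRing.signr_odd on.
Qed.

(** Freeness of [g] turns the hypothesis into [k ^ n = 1] for an integer [k], and for odd [n] this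
    excludes [k = -1]. *)
Lemma endo_cyclic_odd (a : B -> B) (g : B) n (k : int) :
  (forall x y, a (x + y) = a x + a y) -> (forall z : int, bintmul z g = bzero B -> z = 0%R) ->
  odd n -> a g = bintmul k g -> iter n a g = g -> a g = g.
Proof.
move=> aD free on ak; have -> : iter n a g = bintmul (k ^+ n)%R g.
  elim: n {on} => [|n IH]; first by rewrite bintmul1.
  by rewrite iterS IH (badd_endo_int aD) ak -bintmulM -GRing.exprSr.
move=> E; rewrite ak (@odd_expz_eq1 k n) ?bintmul1 //.
apply/GRing.subr0_eq/free; rewrite bintmulD bintmulN bintmul1 E.
exact: baddrN.
Qed.

Lemma swap_inf (J K : B -> Prop) q : is_ideal J -> is_ideal K ->
  (forall x, J x -> K x) -> prime q -> odd q ->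
  inf_soc zero J -> index_is J K q ->
  inf_soc zero K \/
  exists T, [/\ is_ideal T, forall x, T x -> K x, index_is zero T q & inf_soc T K].
Proof.
move=> iJ iK JK pq oq [[g [Jg [gen free]]] /quot_in_soc_zero soc] JKq.
have [Kq Kmq gK [x0 Kx0 nx0]] := index_prime iJ iK JK pq JKq.
have q0 := prime_gt0 pq.
have {}gen x : J x -> exists z : int, x = bintmul z g.
  by move=> /gen[z /bsub0 E]; exists z.
have [gk gc] := soc g Jg.
have Jtf x : J x -> bnatmul q x = bzero B -> x = bzero B.
  move=> /gen[z ->]; rewrite !bnatmulE -bintmulM => /free.
  by move=> h; have -> : z = 0%R by nia.
have Jpow x : K x -> ker_lambda (bpow q x) by move=> /Kmq/soc[].
(* The [q]-th iterate of [blambda x] is [blambda] of an element of [J], hence the identity, and [q]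
   is odd. *)
have KJ x j : K x -> J j -> blambda x j = j.
  move=> Kx /gen[z ->]; rewrite (badd_endo_int (blambdaD x)); congr bintmul.
  have [k ak] := gen _ (ideal_lambda iJ x Jg).
  apply: endo_cyclic_odd (blambdaD x) free oq ak _.
  by rewrite -blambda_pow; apply: Jpow.
have Jmtf x : J x -> bpow q x = bone B -> x = bone B.
  by move=> Jx; rewrite bone0 ker_lambda_pow; [apply: Jtf | case: (soc x Jx)].
have JKc x j : K x -> J j -> x + j = j + x by move=> _ /soc[_ ->].
have JKmc x j : K x -> J j -> x * j = j * x.
  move=> Kx Jj; have [h1 h2] := soc _ Jj.
  by rewrite !bmulE h1 KJ // h2.
(* Either [K] has [q]-torsion outside [J], which provides the complement [T], or [K] has no
   [q]-torsion and is again infinite cyclic. *)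
case: (EM (exists y, [/\ K y, ~ J y & bnatmul q y = bzero B])) => [[y [Ky nJy qy]]|ntor].
  have iT := torsion_part_ideal iJ iK JK pq JKq Jtf Jmtf JKc JKmc Ky nJy qy.
  right; exists (torsion_part K q); split=> //.
  - by move=> x [].
  - exact: (torsion_part_index iJ iK JK pq JKq Jtf JKc Ky nJy qy).
  split.
    exists g; split; first exact: JK.
    split=> [x Kx|z [Kz qz]]; last first.
      by apply: free; apply: Jtf => //; apply: ideal_intmul.
    have [j [t [Jj Tt ->]]] := torsion_part_split iJ iK JK pq JKq Ky nJy qy Kx.
    have [z Ez] := gen j Jj; exists z.
    by rewrite -Ez (JKc t) // ?baddE //; case: Tt.
  move=> x Kx b.
  have [j [t [Jj Tt ->]]] := torsion_part_split iJ iK JK pq JKq Ky nJy qy Kx.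
  (* Since [j] is in the socle, [x = t + j] acts by [blambda] and by additive commutators as [t]
     does, and [t] lies in the ideal [T]. *)
  have [hk hc] := soc j Jj; split.
    have [f Tf E] := ideal_lambda_sub iT b Tt.
    rewrite (JKc t) //; last by case: Tt.
    have -> : j + t = j * t by rewrite bmulE hk.
    by rewrite blambdaM hk E; apply: (ideal_conj iT).
  have := idealD iT Tt (ideal_conj iT b (idealN iT Tt)).
  suff -> : t + j + b + - (t + j) + - b = t + bconj b (- t) by [].
  by rewrite -(baddA t) hc /bconj /gconj !baddE.
have Ktf t : K t -> bnatmul q t = bzero B -> t = bzero B.
  move=> Kt qt; case: (EM (J t)) => [Jt|nJt]; first exact: Jtf.
  by case: ntor; exists t.
have [n En] := gen _ (Kq _ Kx0).
(* Were [n = q n'], the element [x0 - n' g] would be [q]-torsion, hence zero, and [x0] would lie in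
   [J]. *)
have cqn : coprime q `|n|%N.
  rewrite prime_coprime //; apply/negP => /dvdnP[m Em].
  have [n' En'] : exists n' : int, n = (q%:Z * n')%R.
    by exists (sgz n * m%:Z)%R; rewrite {1}[n]intEsg -/(sgz n) Em; lia.
  have Jn' := ideal_intmul iJ n' Jg.
  apply: nx0; suff /bsub0 <- : - bintmul n' g + x0 = bzero B by [].
  apply: Ktf; first by apply: (idealD iK) => //; apply/(idealN iK)/JK.
  have c : - bintmul n' g + x0 = x0 + - bintmul n' g.
    by apply/esym/JKc => //; apply: idealN.
  rewrite bnatmulDr // En En' bintmulM -bintmulN.
  rewrite !bnatmulE -!bintmulM -bintmulD.
  by have -> : (q%:Z * - n' + q%:Z * n' = 0)%R by lia.
have [u [v uv]] : exists u v : int, (u * q%:Z + v * n = 1)%R.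
  case: (Bezoutz q%:Z n) => u [v E]; exists u, v; rewrite E.
  by rewrite /gcdz (eqP cqn).
(* As [q x0 = n g], the relation [u q + v n = 1] gives [q z = g]; this [z] will generate [K]. *)
pose z := bintmul u g + bintmul v x0.
have Kz : K z.
  apply: (idealD iK); first exact: (JK _ (ideal_intmul iJ u Jg)).
  exact: (ideal_intmul iK).
have qz : bnatmul q z = g.
  rewrite /z bnatmulDr; last first.
    by apply/esym/JKc; [apply: ideal_intmul | apply: ideal_intmul].
  have E : bnatmul q (bintmul v x0) = bintmul (v * n)%R g.
    by rewrite bintmulM -En !bnatmulE -!bintmulM GRing.mulrC.
  by rewrite E !bnatmulE -bintmulM -bintmulD GRing.mulrC uv bintmul1.
have qz' : bintmul q z = g := qz.
have x0z : x0 = bintmul n z.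
  apply/esym/bsub0/Ktf.
    by apply: (idealD iK) => //; apply: (idealN iK); apply: (ideal_intmul iK).
  have c : z + x0 = x0 + z.
    rewrite /z baddA (JKc x0 (bintmul u g)) //; last exact: (ideal_intmul iJ).
    by rewrite -!baddA; congr (_ + _); apply: bintmul_comm.
  rewrite -bintmulN bnatmulDr; last exact: bintmul_comm.
  rewrite En !bnatmulE -bintmulM GRing.mulrC bintmulM.
  by rewrite qz' -bintmulD GRing.addNr.
have genz x : K x -> exists m, x = bintmul m z.
  move=> Kx; have [k /gen[c Ec]] := gK x x0 Kx Kx0 nx0.
  exists (k%:Z * n + c * q%:Z)%R; rewrite bintmulD !bintmulM -x0z qz' -Ec.
  by rewrite !baddE.
have freez m : bintmul m z = bzero B -> m = 0%R.
  move=> E; apply: free; rewrite -qz bnatmulE -bintmulM.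
  by rewrite GRing.mulrC bintmulM E bintmul0.
left; split.
  exists z; split=> //; split=> [x /genz[m ->]|m]; last exact: freez.
  by exists m; apply/bsub0.
apply/quot_in_soc_zero => x Kx; split=> b.
  have lz : blambda x z = z.
    have [k ak] := genz _ (ideal_lambda iK x Kz).
    apply: endo_cyclic_odd (blambdaD x) freez oq ak _.
    by rewrite -blambda_pow; apply: Jpow.
  (* With [f] fixed by [blambda x], the [m]-th iterate sends [b] to [b + m f]. The [q]-th iterate is
     the identity, so [q f = 0] and [f = 0]. *)
  have [f Kf E] := ideal_lambda_sub iK b Kx.
  have lf : blambda x f = f.
    by have [m ->] := genz _ Kf; rewrite (badd_endo_int (blambdaD x)) lz.
  have it m : iter m (blambda x) b = b + bnatmul m f.
    elim: m => [|m IH]; first by rewrite baddr0.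
    by rewrite iterS IH blambdaD E (badd_endo_nat (blambdaD x)) lf -baddA.
  rewrite E (Ktf f) ?baddr0 //.
  by apply: (@baddIl _ b); rewrite -it -blambda_pow baddr0; apply: Jpow.
(* Conjugation by [b] sends [z] to some [k z], hence [g = q z] to [k g]. But [g] is central, so
   [k = 1]. *)
have [m ->] := genz _ Kx; apply: bintmul_comm; apply/esym/bconjE.
have [k Ek] := genz _ (ideal_conj iK b Kz).
rewrite Ek; suff -> : k = 1%R by rewrite bintmul1.
apply/GRing.subr0_eq/free; rewrite bintmulD bintmulN bintmul1.
suff -> : bintmul k g = g by rewrite baddE.
rewrite -{1}qz bnatmulE -bintmulM GRing.mulrC bintmulM -Ek.
rewrite -(badd_endo_int (bconjD b)) qz'.
by apply/bconjE.
Qed.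
End Swap.

(** * Splitting infinite cyclic factors *)
Lemma bintmul_ker_lambda (B : brace) (m : int) (x : B) :
  ker_lambda x -> ker_lambda (bintmul m x).
Proof.
by case: m => n hx; [|apply: ker_lambdaN]; apply: ker_lambda_natmul.
Qed.

(** Inside the socle products are sums, and for [x] in [P] the element [blambda b x] is also in the
    socle, so [b * x = b + blambda b x = blambda b x * b]. Multiplicative conjugation is thus
    [blambda b]. *)
Lemma ideal_in_soc (B : brace) (P : B -> Prop) : P (bzero B) ->
  (forall x y, P x -> P y -> P (x + y)) -> (forall x, P x -> P (- x)) ->
  (forall b x, P x -> P (blambda b x)) ->
  (forall x, P x -> ker_lambda x /\ badd_central x) -> is_ideal P.
Proof.
move=> P0 PD PN Pl soc; split=> //; last split.
- split=> [|x y Px Py|x Px]; first by rewrite bone0.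
    by rewrite bmulE; apply: PD => //; apply: Pl.
  by rewrite ker_lambdaV; [apply: PN | case: (soc x Px)].
- by move=> b x Px; have [_ c] := soc x Px; rewrite -c baddK.
- move=> b x Px; have [hk hc] := soc _ (Pl b x Px).
  suff -> : b * x * binv b = blambda b x by apply: Pl.
  have -> : b * x = blambda b x * b by rewrite bmulE -hc [RHS]bmulE hk.
  by rewrite bmulK.
Qed.

(* The set [F + n Z g]. *)
Definition cyc_mult (B : brace) (F : B -> Prop) (g : B) (n : nat) (x : B) :=
  exists z : int, F (- bintmul (n%:Z * z)%R g + x).

Section CyclicSocle.
Variables (B : brace) (g : B).
Local Notation zero := (@zero_ideal B).
Hypotheses (gk : ker_lambda g) (gc : badd_central g)
  (gl : forall b, exists k : int, blambda b g = bintmul k g)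
  (gfree : forall z : int, bintmul z g = bzero B -> z = 0%R).

Let cycE n x : cyc_mult zero g n x <-> exists z : int, x = bintmul (n%:Z * z)%R g.
Proof. by split=> -[z h]; exists z; [apply/esym/bsub0 | apply/bsub0]. Qed.

Let cyc_soc n x : cyc_mult zero g n x -> ker_lambda x /\ badd_central x.
Proof.
by move=> /cycE[z ->]; split=> [|b]; [exact: bintmul_ker_lambda | exact: bintmul_comm].
Qed.

Lemma cyc_mult_ideal0 n : is_ideal (cyc_mult zero g n).
Proof.
apply: ideal_in_soc; last exact: cyc_soc.
- by apply/cycE; exists 0%R; rewrite GRing.mulr0.
- move=> x y /cycE[z ->] /cycE[w ->]; apply/cycE; exists (z + w)%R.
  by rewrite GRing.mulrDr bintmulD.
- move=> x /cycE[z ->]; apply/cycE; exists (- z)%R.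
  by rewrite GRing.mulrN bintmulN.
- move=> b x /cycE[z ->]; have [k E] := gl b; apply/cycE; exists (z * k)%R.
  by rewrite (badd_endo_int (blambdaD b)) E -bintmulM GRing.mulrA.
Qed.

Lemma cyc_mult_inf_soc0 n : (0 < n)%N -> inf_soc zero (cyc_mult zero g n).
Proof.
move=> n0; split; last by apply/quot_in_soc_zero; apply: cyc_soc.
exists (bintmul n g); split; first by apply/cycE; exists 1%R; rewrite GRing.mulr1.
split=> [x /cycE[z ->]|z]; last by rewrite /zero_ideal -bintmulM => /gfree; nia.
by exists z; apply/bsub0; rewrite -bintmulM GRing.mulrC.
Qed.

Lemma cyc_mult_index0 n r : (0 < n)%N -> (0 < r)%N ->
  index_is (cyc_mult zero g (r * n)) (cyc_mult zero g n) r.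
Proof.
move=> n0 r0; exists (fun i : 'I_r => bintmul (n%:Z * i%:Z)%R g); split.
- by move=> i; apply/cycE; exists (Posz i).
- move=> x /cycE[z ->].
  have rz : (r%:Z != 0)%R by lia.
  have z1 := modz_ge0 z rz; have z2 := ltz_pmod z (_ : (0 < r%:Z)%R).
  have lt : (`|(z %% r%:Z)%Z|%N < r)%N by lia.
  exists (Ordinal lt); apply/cycE; exists (z %/ r%:Z)%Z.
  rewrite -bintmulN -bintmulD; congr bintmul.
  have /= -> : (`|(z %% r%:Z)%Z|%N%:Z = (z %% r%:Z)%Z)%R by lia.
  by rewrite {2}(divz_eq z r%:Z); nia.
- move=> i j /cycE[z]; rewrite -bintmulN -bintmulD => E.
  have {}E : (- (n%:Z * i%:Z) + n%:Z * j%:Z = (r * n)%N%:Z * z)%R.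
    apply/GRing.subr0_eq/gfree; rewrite bintmulD E bintmulN.
    exact: baddrN.
  have {}E : (j%:Z - i%:Z = r%:Z * z)%R by nia.
  have := ltn_ord i; have := ltn_ord j => hj hi; apply/val_inj => /=.
  have z0 : z = 0%R by nia.
  by move: E; rewrite z0; lia.
Qed.
End CyclicSocle.

(** Exposes the generator that [quot_inf_cyclic] hides under an existential. *)
Definition inf_gen (B : brace) (F J : B -> Prop) (g : B) :=
  [/\ J g, forall x, J x -> exists z : int, F (- bintmul z g + x)
    & forall z : int, F (bintmul z g) -> z = 0%R].

Lemma inf_socP (B : brace) (F J : B -> Prop) :
  inf_soc F J <-> (exists g, inf_gen F J g) /\ quot_in_soc F J.
Proof.
by split=> -[[g [g1 g2]] s]; split=> //; exists g; [case: g2 | split].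
Qed.

Section CyclicQuotient.
Variables (B : brace) (F J : B -> Prop) (g : B).
Hypotheses (iF : is_ideal F) (iJ : is_ideal J) (FJ : forall x, F x -> J x)
  (gP : inf_gen F J g) (soc : quot_in_soc F J).

Lemma cyc_mult_spec n : (0 < n)%N ->
  [/\ is_ideal (cyc_mult F g n), inf_soc F (cyc_mult F g n)
    & forall r, (0 < r)%N -> index_is (cyc_mult F g (r * n)) (cyc_mult F g n) r].
Proof.
move=> n0; case: gP => Jg gen free.
have [Q [phi [hphi surj FE Kex]]] := quotient_reduction iF.
have [J' iJ' JE] := Kex J iJ FJ.
have mE m : cyc_mult F g m = (fun x => cyc_mult (@zero_ideal Q) (phi g) m (phi x)).
  apply/funext => x; apply/propext; rewrite FE.
  by split=> -[z h]; exists z; move: h; rewrite (homD hphi) (homN hphi) (hom_intmul hphi).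
have soc' : quot_in_soc (@zero_ideal Q) J'.
  move=> q; have [x <-] := surj q => Jx b; have [c <-] := surj b.
  have := soc; rewrite FE JE => /(_ x Jx c).
  by rewrite !(homD hphi, homN hphi, hom_lambda hphi).
move/quot_in_soc_zero: soc' => soc'.
have Jg' : J' (phi g) by move: Jg; rewrite JE.
have [gk gc] := soc' _ Jg'.
have gl b : exists k : int, blambda b (phi g) = bintmul k (phi g).
  have [c <-] := surj b; rewrite -(hom_lambda hphi).
  have [z] := gen _ (ideal_lambda iJ c Jg); rewrite FE => h; exists z.
  by apply/esym/bsub0; rewrite -(hom_intmul hphi) -(homN hphi) -(homD hphi).
have gfree z : bintmul z (phi g) = bzero Q -> z = 0%R.
  by move=> h; apply: free; rewrite FE /zero_ideal (hom_intmul hphi).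
split=> [||r r0]; rewrite ?mE.
- exact/(is_ideal_comp hphi)/cyc_mult_ideal0.
- by rewrite FE; apply/(inf_soc_comp hphi surj)/cyc_mult_inf_soc0.
- by apply/(index_is_comp hphi surj)/cyc_mult_index0.
Qed.

Lemma cyc_mult1 : cyc_mult F g 1 = J.
Proof.
case: gP => Jg gen free; apply/funext => x; apply/propext; split=> [[z]|/gen[z h]].
  by rewrite GRing.mul1r => /FJ/(ideal_subl iJ); apply; apply: ideal_intmul.
by exists z; rewrite GRing.mul1r.
Qed.

Lemma cyc_mult_sub n x : F x -> cyc_mult F g n x.
Proof. by move=> Fx; exists 0%R; rewrite GRing.mulr0 bopp0 badd0. Qed.

Lemma cyc_mult_mul n r x : cyc_mult F g (r * n) x -> cyc_mult F g n x.
Proof. by move=> [z h]; exists (r%:Z * z)%R; rewrite GRing.mulrA -PoszM mulnC. Qed.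

End CyclicQuotient.

(** * Series of ideals with factors of prime order *)

Inductive prime_chain (B : brace) (P : nat -> Prop) (I K : B -> Prop) : Prop :=
  | prime_chain_refl : is_ideal K -> I = K -> prime_chain P I K
  | prime_chain_step J q : is_ideal I -> (forall x, I x -> J x) -> prime q -> P q ->
      index_is I J q -> prime_chain P J K -> prime_chain P I K.
Arguments prime_chain_step {B P I K} J q.

Section PrimeChain.
Variables (B : brace) (P : nat -> Prop).
Implicit Types I J K : B -> Prop.

Lemma prime_chain_ideal I K : prime_chain P I K -> is_ideal I /\ is_ideal K.
Proof. by elim=> [{}I {}K iK ->|{}I {}K J q iI IJ pq Pq h hJK [iJ iK]]. Qed.

Lemma prime_chain_sub I K : prime_chain P I K -> forall x, I x -> K x.
Proof. by elim=> [{}I {}K iK -> //|{}I {}K J q iI IJ pq Pq h hJK IH x /IJ/IH]. Qed.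

Lemma prime_chain_trans I J K : prime_chain P I J -> prime_chain P J K -> prime_chain P I K.
Proof.
move=> h; elim: h K => [{}I {}J _ -> //|{}I {}J L q iI IL pq Pq h hLJ IH K hJK].
exact: (prime_chain_step L q) (IH K hJK).
Qed.

Lemma prime_chain1 I K q : is_ideal I -> is_ideal K -> (forall x, I x -> K x) ->
  prime q -> P q -> index_is I K q -> prime_chain P I K.
Proof.
by move=> iI iK IK pq Pq h; apply: (prime_chain_step K q) => //; apply: prime_chain_refl.
Qed.

Lemma prime_chain_cyc_mult (F J : B -> Prop) g m : is_ideal F -> is_ideal J ->
  (forall x, F x -> J x) -> inf_gen F J g -> quot_in_soc F J -> (0 < m)%N ->
  (forall r, prime r -> (r %| m)%N -> P r) -> prime_chain P (cyc_mult F g m) J.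
Proof.
move=> iF iJ FJ gP soc; elim/ltn_ind: m => m IH m0 mP.
have spec n := @cyc_mult_spec B F J g iF iJ FJ gP soc n.
case: (leqP m 1) => [m1|m1].
  apply: prime_chain_refl => //.
  have -> : m = 1%N by lia.
  exact: cyc_mult1.
have pr := pdiv_prime m1; set r := pdiv m in pr.
have Em : m = (r * (m %/ r))%N by rewrite mulnC divnK // pdiv_dvd.
have r1 := prime_gt1 pr; set n := (m %/ r)%N in Em *.
have n0 : (0 < n)%N by lia.
have [in_ _ idx] := spec n n0; have [im _ _] := spec m m0.
apply: (prime_chain_step (cyc_mult F g n) r) => //.
- by rewrite Em => x; apply: cyc_mult_mul.
- by apply: mP => //; apply: pdiv_dvd.
- by rewrite Em; apply: idx; lia.
- apply: IH => //; first by nia.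
  by move=> s ps sn; apply: mP; rewrite // Em dvdn_mull.
Qed.
End PrimeChain.

(** The iterate [c] of [a] of order [q.-1] fixes [F] pointwise and moves [b] by some [u] in [F].
    Hence its [n]-th iterate adds [n u] to [b], and [q u = 0]. *)
Lemma unipotent_iter (B : brace) (F : B -> Prop) q (a : B -> B) : is_ideal F ->
  prime q -> index_is (@zero_ideal B) F q ->
  (forall x y, a (x + y) = a x + a y) -> injective a ->
  (forall x, F x -> F (a x)) -> (forall b, F (a b + - b)) ->
  forall b, iter (q * q.-1) a b = b.
Proof.
move=> iF pq Fq aD ai aF ab b; rewrite iterM.
have F0 x : zero_ideal x -> F x by move=> ->; apply: ideal0.
have [qF _ _ _] := index_prime (zero_is_ideal B) iF F0 pq Fq.
have /index_zero[f [f1 f2 f3]] := Fq.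
pose c := iter q.-1 a.
have cF x : F x -> c x = x.
  exact: (prime_order_aut (@baddA B) (@badd0 B) (@baddN B) pq (idealD iF) f1 f2 f3 aD ai aF).
have cD x y : c (x + y) = c x + c y.
  by rewrite /c; elim: q.-1 => //= n ->; rewrite aD.
pose u := c b + - b.
have Fu : F u.
  rewrite /u /c; elim: q.-1 => [|n IH] /=; first by rewrite baddE; apply: ideal0.
  by have := idealD iF (ab (iter n a b)) IH; rewrite !baddE.
have it n : iter n c b = bnatmul n u + b.
  elim: n => [|n IH]; first by rewrite badd0.
  rewrite iterS IH cD cF; last exact: ideal_natmul.
  have -> : c b = u + b by rewrite /u baddE.
  by rewrite baddA -bnatmulSr.
by rewrite it (qF u Fu) badd0.
Qed.

Lemma split_inf0 (B : brace) (P : nat -> Prop) (F J : B -> Prop) q :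
  is_ideal F -> is_ideal J -> (forall x, F x -> J x) -> prime q ->
  index_is (@zero_ideal B) F q -> inf_soc F J ->
  (forall r, prime r -> (r <= q)%N -> P r) ->
  exists N, [/\ is_ideal N, forall x, N x -> J x, inf_soc (@zero_ideal B) N,
    forall x, N x -> F x -> x = bzero B & prime_chain P N J].
Proof.
move=> iF iJ FJ pq Fq /inf_socP[[g gP] soc] Pq.
have [Jg gen free] := gP.
have [q1 q0] := (prime_gt1 pq, prime_gt0 pq).
have F0 x : zero_ideal x -> F x by move=> ->; apply: ideal0.
have [qF _ _ _] := index_prime (zero_is_ideal B) iF F0 pq Fq.
have [Q [phi [hphi surj FE Kex]]] := quotient_reduction iF.
have [J' iJ' JE] := Kex J iJ FJ.
have phiE x y : F (- x + y) <-> phi x = phi y.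
  by rewrite FE /zero_ideal (homD hphi) (homN hphi); apply: bsub0.
have gk : ker_lambda (phi g).
  move=> b; have [c <-] := surj b; have [+ _] := soc g Jg c.
  rewrite FE /zero_ideal (homD hphi) (homN hphi) (hom_lambda hphi) => h.
  by apply: (@baddIr _ (- phi c)); rewrite h baddE.
set n := (q * q.-1)%N.
have n0 : (0 < n)%N by rewrite /n; lia.
(* A multiplicative power, since [blambda] is a homomorphism on the multiplicative group:
   [blambda u] is the [n]-th iterate of [blambda g], which is the identity. *)
pose u := bpow n g.
have Ju : J u by apply: ideal_pow.
have uk : ker_lambda u.
  move=> b; rewrite /u blambda_pow.
  apply: (unipotent_iter iF pq Fq) => [||x|c].
  - exact: blambdaD.
  - exact: blambda_inj.
  - exact: ideal_lambda.
  - by have [] := soc g Jg c.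
(* An additive multiple makes conjugation trivial in the same way, so [w] lies in the socle. *)
pose w := bnatmul n u.
have wk : ker_lambda w by apply: ker_lambda_natmul.
have wc : badd_central w.
  move=> b; apply/bconjE; rewrite /w bconj_natmul.
  apply: (unipotent_iter iF pq Fq) => [||x|c].
  - exact: bconjD.
  - exact: bconj_inj.
  - exact: ideal_conj.
  - by have [] := soc u Ju c.
have phiw : phi w = bintmul (n * n)%N (phi g).
  by rewrite /w /u (hom_natmul hphi) (hom_pow hphi) ker_lambda_pow // -bnatmulM.
(* Each [blambda b w] is [k w + f] with [f] in [F]. The factor [q] kills [f], so the multiples of
   [h] are [blambda]-invariant. *)
pose h := bnatmul q w.
have phih : phi h = bintmul (q * (n * n))%N (phi g).
  by rewrite /h (hom_natmul hphi) phiw !bnatmulE -bintmulM PoszM.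
have m0 : (0 < q * (n * n))%N by rewrite muln_gt0 q0 muln_gt0 n0.
have hk : ker_lambda h by apply: ker_lambda_natmul.
have hc : badd_central h by apply: badd_central_natmul.
have hl b : exists k : int, blambda b h = bintmul k h.
  have [k Ek] := gen _ (ideal_lambda iJ b Jg); exists k.
  pose f := - bintmul k w + blambda b w.
  have Ff : F f.
    apply/phiE; rewrite (hom_intmul hphi) (hom_lambda hphi) phiw.
    rewrite (badd_endo_int (blambdaD (phi b))) -(hom_lambda hphi).
    have /phiE <- := Ek.
    by rewrite (hom_intmul hphi) -!bintmulM GRing.mulrC.
  rewrite /h (badd_endo_nat (blambdaD b)).
  have -> : blambda b w = bintmul k w + f by rewrite /f !baddE.
  rewrite bnatmulDr; last exact: bintmul_comm.
  by rewrite (qF f Ff) baddr0 !bnatmulE -!bintmulM GRing.mulrC.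
have hF (z : int) : F (bintmul z h) -> z = 0%R.
  rewrite FE /zero_ideal (hom_intmul hphi) phih -bintmulM -(hom_intmul hphi) => E.
  have : F (bintmul (z * (q * (n * n))%N%:Z)%R g) by rewrite FE.
  by move/free; nia.
have hfree (z : int) : bintmul z h = bzero B -> z = 0%R.
  by move=> E; apply: hF; rewrite E; apply: ideal0.
have N0 x : cyc_mult (@zero_ideal B) h 1 x -> exists z, x = bintmul z h.
  by move=> [z /bsub0 <-]; exists z; rewrite GRing.mul1r.
have iN := cyc_mult_ideal0 hk hc hl 1.
have NF x : cyc_mult (@zero_ideal B) h 1 x -> F x -> x = bzero B.
  by move=> /N0[z ->] /hF ->.
exists (cyc_mult (@zero_ideal B) h 1); split=> //.
- by move=> x /N0[z ->]; apply/(ideal_intmul iJ)/(ideal_natmul iJ)/(ideal_natmul iJ).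
- exact: cyc_mult_inf_soc0.
have [iM _ _] := cyc_mult_spec iF iJ FJ gP soc m0.
have NM x : cyc_mult (@zero_ideal B) h 1 x -> cyc_mult F g (q * (n * n)) x.
  move=> /N0[z ->]; exists z; apply/phiE.
  by rewrite !(hom_intmul hphi) phih -bintmulM GRing.mulrC.
(* The intermediate ideal is the sum of [F] and the multiples of [h], which meet trivially, so its
   lowest factor has order [q]. Above it only primes dividing [q] or [q - 1] occur. *)
apply: (prime_chain_step (cyc_mult F g (q * (n * n))) q) => //.
- by apply: Pq.
- have /index_zero[f [f1 f2 f3]] := Fq.
  exists f; split=> [i|x [z] /phiE E|i j Nij].
  + exact: cyc_mult_sub.
  + have : F (- bintmul z h + x).
      by apply/phiE; rewrite -E !(hom_intmul hphi) phih -bintmulM GRing.mulrC.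
    move=> /f2[i Ei]; exists i, z; rewrite GRing.mul1r.
    have -> : x = bintmul z h + f i by rewrite -Ei !baddE.
    by rewrite (bintmul_comm z (hc (f i))) /zero_ideal !baddE.
  + apply/f3/bsub0/NF => //.
    by apply: (idealD iF) => //; apply: (idealN iF).
- apply: prime_chain_cyc_mult => // r pr; rewrite /n !Euclid_dvdM // => rq.
  apply: Pq => //; have : (r %| q) || (r %| q.-1) by case/orP: rq => [->//|/orP[]].
  by case/orP => /dvdn_leq; lia.
Qed.

Lemma prime_chain_comp (B Q : brace) (phi : B -> Q) P (N J : Q -> Prop) :
  is_hom phi -> (forall q, exists x, phi x = q) -> prime_chain P N J ->
  prime_chain P (fun x => N (phi x)) (fun x => J (phi x)).
Proof.
move=> hphi surj; elim=> [{}N {}J iJ ->|{}N {}J L q iN NL pq Pq h _ IH].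
  by apply: prime_chain_refl => //; apply: is_ideal_comp.
apply: (prime_chain_step (fun x => L (phi x)) q) => //.
- exact: is_ideal_comp.
- by move=> x; apply: NL.
- exact/(index_is_comp hphi surj).
Qed.

(** * The same steps above an arbitrary ideal, and their iteration along chains *)

Section Relative.
Variables (B : brace).
Implicit Types I J K F N T : B -> Prop.

Lemma split_inf P I F J q : is_ideal I -> is_ideal F -> is_ideal J ->
  (forall x, I x -> F x) -> (forall x, F x -> J x) -> prime q ->
  index_is I F q -> inf_soc F J -> (forall r, prime r -> (r <= q)%N -> P r) ->
  exists N, [/\ is_ideal N, (forall x, I x -> N x) /\ (forall x, N x -> J x), inf_soc I N,
    forall x, N x -> F x -> I x & prime_chain P N J].
Proof.
move=> iI iF iJ IF FJ pq; have IJ x (h : I x) := FJ x (IF x h).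
have [Q [phi [hphi surj IE Kex]]] := quotient_reduction iI.
have [F' iF' FE] := Kex F iF IF; have [J' iJ' JE] := Kex J iJ IJ.
rewrite IE FE JE => /(index_is_comp hphi surj) h /(inf_soc_comp hphi surj) s Pq.
have F'J' y : F' y -> J' y.
  by have [x <-] := surj y; have := FJ x; rewrite FE JE.
have [N [iN NJ sN NF cN]] := split_inf0 iF' iJ' F'J' pq h s Pq.
exists (fun x => N (phi x)); split.
- exact: is_ideal_comp.
- split=> x; last exact: NJ.
  by move=> ->; apply: ideal0.
- exact/(inf_soc_comp hphi surj).
- by move=> x; apply: NF.
- exact: prime_chain_comp.
Qed.

(** Induction along the chain. For the lowest step from [I] to [L], the part above [L] yields [N]
    with [N] and [F] meeting inside [L], and [split_inf] then removes [L/I] from [N]. *)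
Lemma split_chain (P : nat -> Prop) I F J : (forall q r, P q -> prime r -> (r <= q)%N -> P r) ->
  prime_chain P I F -> is_ideal J -> (forall x, F x -> J x) -> inf_soc F J ->
  exists N, [/\ is_ideal N, inf_soc I N, (forall x, I x -> N x) /\ (forall x, N x -> J x),
    forall x, N x -> F x -> I x & prime_chain P N J].
Proof.
move=> Pdown c iJ; elim: c => [{}I {}F _ -> FJ s|{}I {}F L q iI IL pq Pq h cL IH FJ s].
  by exists J; split=> //; apply: prime_chain_refl.
have [N [iN sN [LN NJ] NF cN]] := IH FJ s.
have [iL _] := prime_chain_ideal cL.
have [M [iM [IM MN] sM ML cM]] := split_inf iI iL iN IL LN pq h sN (fun r => Pdown q r Pq).
exists M; split=> //.
- by split=> // x /MN/NJ.
- by move=> x Mx Fx; apply: ML => //; apply: NF => //; apply: MN.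
- exact: prime_chain_trans cN.
Qed.

Lemma swap_prime_rel I J K r q : is_ideal I -> is_ideal J -> is_ideal K ->
  (forall x, I x -> J x) -> (forall x, J x -> K x) -> prime r -> prime q -> (r < q)%N ->
  index_is I J r -> index_is J K q ->
  exists T, [/\ is_ideal T, forall x, I x -> T x, forall x, T x -> K x,
    index_is I T q & index_is T K r].
Proof.
move=> iI iJ iK IJ JK pr pq rq; have IK x (h : I x) := JK x (IJ x h).
have [Q [phi [hphi surj IE Kex]]] := quotient_reduction iI.
have [J' iJ' JE] := Kex J iJ IJ; have [K' iK' KE] := Kex K iK IK.
rewrite IE JE KE => /(index_is_comp hphi surj) h /(index_is_comp hphi surj) h'.
have J'K' y : J' y -> K' y.
  by have [x <-] := surj y; have := JK x; rewrite JE KE.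
have [T [iT TK h1 h2]] := swap_prime iJ' iK' J'K' pr pq rq h h'.
exists (fun x => T (phi x)); split.
- exact: is_ideal_comp.
- by move=> x ->; apply: ideal0.
- by move=> x; apply: TK.
- exact/(index_is_comp hphi surj).
- exact/(index_is_comp hphi surj).
Qed.

Lemma swap_inf_rel I J K q : is_ideal I -> is_ideal J -> is_ideal K ->
  (forall x, I x -> J x) -> (forall x, J x -> K x) -> prime q -> odd q ->
  inf_soc I J -> index_is J K q ->
  inf_soc I K \/
  exists T, [/\ is_ideal T, forall x, I x -> T x, forall x, T x -> K x,
    index_is I T q & inf_soc T K].
Proof.
move=> iI iJ iK IJ JK pq oq; have IK x (h : I x) := JK x (IJ x h).
have [Q [phi [hphi surj IE Kex]]] := quotient_reduction iI.
have [J' iJ' JE] := Kex J iJ IJ; have [K' iK' KE] := Kex K iK IK.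
rewrite IE JE KE => /(inf_soc_comp hphi surj) h /(index_is_comp hphi surj) h'.
have J'K' y : J' y -> K' y.
  by have [x <-] := surj y; have := JK x; rewrite JE KE.
case: (swap_inf iJ' iK' J'K' pq oq h h') => [s|[T [iT TK h1 h2]]].
  by left; apply/(inf_soc_comp hphi surj).
right; exists (fun x => T (phi x)); split.
- exact: is_ideal_comp.
- by move=> x ->; apply: ideal0.
- by move=> x; apply: TK.
- exact/(index_is_comp hphi surj).
- exact/(inf_soc_comp hphi surj).
Qed.

Lemma push_prime p r I J T : prime_chain (fun q => p < q)%N J T -> is_ideal I ->
  (forall x, I x -> J x) -> prime r -> (r <= p)%N -> index_is I J r ->
  exists T', [/\ prime_chain (fun q => p < q)%N I T', forall x, T' x -> T x
    & index_is T' T r].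
Proof.
move=> c iI IJ pr rp; elim: c I iI IJ =>
  [{}J {}T iT ->|{}J {}T L q iJ JL pq pltq h cL IH] I iI IJ Ir.
  by exists I; split=> //; apply: prime_chain_refl.
have [iL _] := prime_chain_ideal cL.
have [S [iS IS SL h1 h2]] := swap_prime_rel iI iJ iL IJ JL pr pq (leq_ltn_trans rp pltq) Ir h.
have [T' [c' T'T idx]] := IH S iS SL h2.
by exists T'; split=> //; apply: (prime_chain_step S q).
Qed.

Lemma push_inf p I J T : prime_chain (fun q => p < q)%N J T -> is_ideal I ->
  (forall x, I x -> J x) -> (2 <= p)%N -> inf_soc I J ->
  exists T', [/\ prime_chain (fun q => p < q)%N I T', forall x, T' x -> T x
    & inf_soc T' T].
Proof.
move=> c iI IJ p2; elim: c I iI IJ =>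
  [{}J {}T iT ->|{}J {}T L q iJ JL pq pltq h cL IH] I iI IJ Is.
  by exists I; split=> //; apply: prime_chain_refl.
have [iL _] := prime_chain_ideal cL.
have oq : odd q.
  by apply: contraTT (leq_ltn_trans p2 pltq) => /(prime_oddPn pq) ->.
(* Either the infinite factor absorbs the factor of order [q] and the chain gets shorter, or the two
   are interchanged. *)
case: (swap_inf_rel iI iJ iL IJ JL pq oq Is h) => [s|[S [iS IS SL h1 h2]]].
  by apply: IH => // x /IJ/JL.
have [T' [c' T'T idx]] := IH S iS SL h2.
by exists T'; split=> //; apply: (prime_chain_step S q).
Qed.
End Relative.

(** * Sorting and residual finiteness *)
Inductive soluble_chain (B : brace) (P : nat -> Prop) (I : B -> Prop) : Prop :=
  | soluble_chain_top : (forall x, I x) -> soluble_chain P I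
  | soluble_chain_prime J q : is_ideal I -> is_ideal J -> (forall x, I x -> J x) ->
      prime q -> P q -> index_is I J q -> soluble_chain P J -> soluble_chain P I
  | soluble_chain_inf J : is_ideal I -> is_ideal J -> (forall x, I x -> J x) ->
      inf_soc I J -> soluble_chain P J -> soluble_chain P I.

(** The series is processed from the top down, [m] counting the factors treated. A new lowest factor
    of order [> p] extends the chain of large primes; any other is pushed above that chain and joins
    the upper part. *)
Lemma supersoluble_sort (B : brace) p : supersoluble B -> (2 <= p)%N ->
  exists T, prime_chain (fun q => p < q)%N (@zero_ideal B) T /\
    soluble_chain (fun q => q <= p)%N T.
Proof.
move=> [n [I [I0 In iI IS fac]]] p2.
have -> : @zero_ideal B = I 0 by apply/funext => x; apply/propext; rewrite I0.
suff H m : (m <= n)%N -> exists T, prime_chain (fun q => p < q)%N (I (n - m)%N) T /\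
    soluble_chain (fun q => q <= p)%N T.
  by have := H n (leqnn n); rewrite subnn.
elim: m => [_|m IH mn].
  exists (I n); rewrite subn0; split; first exact: prime_chain_refl.
  exact: soluble_chain_top.
have [T [cT sT]] := IH (ltnW mn).
have iT := (prime_chain_ideal cT).2.
have lt : (n - m.+1 < n)%N by lia.
have E : (n - m)%N = (n - m.+1).+1 by lia.
have IJ := IS (n - m.+1)%N; rewrite -E in IJ.
have := fac _ lt; rewrite -E => -[s|[q [pq idx]]].
  have [T' [c' T'T s']] := push_inf cT (iI _) IJ p2 s.
  exists T'; split=> //; apply: (@soluble_chain_inf _ _ _ T) => //.
  by have [] := prime_chain_ideal c'.
case: (leqP q p) => qp; last by exists T; split=> //; apply: (prime_chain_step _ q) cT.
have [T' [c' T'T s']] := push_prime cT (iI _) IJ pq qp idx.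
exists T'; split=> //; apply: (@soluble_chain_prime _ _ _ T q) => //.
by have [] := prime_chain_ideal c'.
Qed.

(** Climbs the series with an ideal [I] below [F] that avoids [x] and is joined to [F] by primes in
    [P]. At an infinite factor [J/F], the new [I] comes from [split_chain] if [x] is in [F], is [J]
    if [x] is outside [J], and is otherwise some [F + m Z g]. *)
Lemma soluble_chain_residual (B : brace) (P : nat -> Prop) (I F : B -> Prop) x :
  P 2 -> (forall q r, P q -> prime r -> (r <= q)%N -> P r) ->
  soluble_chain P F -> prime_chain P I F -> ~ I x ->
  exists2 M, prime_chain P M (fun _ : B => True) & ~ M x.
Proof.
move=> P2 Pdown s; elim: s I => {}F.
- move=> Ft I c nIx; exists I => //.
  suff <- : F = (fun _ => True) by [].
  by apply/funext => y; apply/propext.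
- move=> J q iF iJ FJ pq Pq h s IH I c; apply: IH.
  exact: prime_chain_trans c (prime_chain1 iF iJ FJ pq Pq h).
- move=> J iF iJ FJ fs s IH I c nIx.
  case: (EM (F x)) => [Fx|nFx].
    have [N [iN sN _ NF cN]] := split_chain Pdown c iJ FJ fs.
    by apply: (IH N cN) => /NF/(_ Fx).
  case: (EM (J x)) => [Jx|nJx]; last first.
    by apply: (IH J) nJx; apply: prime_chain_refl.
  have [[g gP] soc] := (inf_socP F J).1 fs; have [Jg gen free] := gP.
  have [z Ez] := gen x Jx.
  (* Any power of 2 exceeding the absolute value of [z] serves: it cannot divide [z] unless [z = 0],
     that is, unless [x] is in [F]. *)
  pose m := (2 ^ `|z|)%N; have m0 : (0 < m)%N by rewrite expn_gt0.
  apply: (IH (cyc_mult F g m)).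
    apply: prime_chain_cyc_mult => // r pr; rewrite Euclid_dvdX // => /andP[].
    by rewrite dvdn_prime2 // => /eqP ->.
  move=> [w Ew]; have Ezw : (- (m%:Z * w) + z = 0)%R.
    apply: free; rewrite bintmulD bintmulN.
    by apply: (ideal_trans iF Ew); apply: ideal_sym.
  have zlt : (`|z| < m)%N by apply: ltn_expl.
  have Ez' : z = (m%:Z * w)%R by lia.
  have z0 : z = 0%R.
    apply/eqP; rewrite -absz_eq0 -leqn0 leqNgt; apply/negP => z1.
    have mz : (m %| `|z|)%N by rewrite Ez' abszM dvdn_mulr.
    by have := dvdn_leq z1 mz; lia.
  by apply: nFx; move: Ez; rewrite z0 bopp0 badd0.
Qed.

(** The sums [c i + d j] of representatives of [K/J] and [J/I] represent [K/I]. *)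
Lemma index_is_mul (B : brace) (I J K : B -> Prop) a b : is_ideal I -> is_ideal J ->
  is_ideal K -> (forall x, I x -> J x) -> (forall x, J x -> K x) ->
  index_is I J a -> index_is J K b -> index_is I K (b * a).
Proof.
move=> iI iJ iK IJ JK [d [d1 d2 d3]] [c [c1 c2 c3]].
have <- : #|{: 'I_b * 'I_a}| = (b * a)%N by rewrite card_prod !card_ord.
pose f (u : 'I_b * 'I_a) := c u.1 + d u.2.
exists (fun i => f (enum_val i)); split=> [i|x|i j].
- by apply: (idealD iK) => //; apply: JK.
- move=> /c2[i /d2[j h]]; exists (enum_rank (i, j)).
  by rewrite enum_rankK /f boppD -baddA.
- move=> h; apply: enum_val_inj; move: h.
  case: (enum_val i) (enum_val j) => [i1 j1] [i2 j2]; rewrite /f /= => h.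
  have E : i1 = i2.
    apply/c3; have := idealD iJ (d1 j1) (idealD iJ (IJ _ h) (idealN iJ (d1 j2))).
    by rewrite !baddE.
  rewrite E in h *; congr pair; apply: d3.
  by move: h; rewrite !baddE.
Qed.

Lemma prime_chain_index (B : brace) (P : nat -> Prop) (I K : B -> Prop) :
  prime_chain P I K ->
  exists n, index_is I K n /\ (forall q, prime q -> (q %| n)%N -> P q).
Proof.
elim=> [{}I {}K iK ->|{}I {}K J q iI IJ pq Pq h c [n [hn nP]]].
  exists 1%N; split; last by move=> q /prime_gt1; rewrite dvdn1; lia.
  exists (fun=> bzero B); split=> [_|x Kx|i j _]; last by rewrite !ord1.
    exact: ideal0.
  by exists ord0; rewrite bopp0 badd0.
have [iJ iK] := prime_chain_ideal c.
exists (n * q)%N; split; first exact: index_is_mul (prime_chain_sub c) h hn.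
move=> r pr; rewrite Euclid_dvdM // => /orP[/(nP _ pr)//|].
by rewrite dvdn_prime2 // => /eqP ->.
Qed.

Theorem theorem3p25 (B : brace) (p : nat) :
  supersoluble B ->
  (p = 2 \/ in_pi_add B p) ->
  (forall r, (r = 2 \/ in_pi_add B r) -> r <= p) ->
  residually_pi_finite_le B p.
Proof.
move=> ss _ pmax x hx; have p2 : (2 <= p)%N by apply: pmax; left.
have [T [c s]] := supersoluble_sort ss p2.
have {}s : soluble_chain (fun q => q <= p)%N (@zero_ideal B).
  (* A nonempty chain of large primes would start with an ideal of prime order [q > p], whose
     elements are additive [q]-torsion, against the maximality of [p]. *)
  case: c s => [_ -> //|J q i0 JJ pq pltq Jq cJ _].
  have [iJ _] := prime_chain_ideal cJ.
  have [qJ _ _ [y Jy ny]] := index_prime i0 iJ JJ pq Jq.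
  suff : (q <= p)%N by lia.
  by apply: pmax; right; split=> //; exists y; split=> //; apply: qJ.
case: (EM (x = bzero B)) => // nx.
have [||M cM] := soluble_chain_residual p2 _ s (_ : prime_chain _ (@zero_ideal B) _) nx.
- by move=> q r qp _ /leq_trans; apply.
- by apply: prime_chain_refl => //; apply: zero_is_ideal.
have [iM _] := prime_chain_ideal cM.
by case; apply: hx => //; apply: prime_chain_index.
Qed.
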